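(* Let $A, B > 0$ be bounded linear operators on a Hilbert space $\mathcal{H}$, let $n \geq 2$ be an integer, and let $t > s > 0$ be real numbers such that $$\left( B^{\frac{s}{n}}\, A^{\frac{s-t}{n}}\, \underbrace{\left(B^{\frac{2t}{n}} A^{\frac{s-t}{n}}\right)\left(B^{\frac{2t}{n}} A^{\frac{s-t}{n}}\right)\cdots \left(B^{\frac{2t}{n}} A^{\frac{s-t}{n}}\right)}_{n-1 \text{ factors}}\, B^{\frac{s}{n}} \right)^{\frac{n}{(n+2)s+(n-2)t}} \geq B,$$ where in the product inside the outer parentheses $A^{\frac{s-t}{n}}$ appears $n$ times and $B^{\frac{2t}{n}}$ appears $n-1$ times, alternating, with $B^{\frac{s}{n}}$ at both ends. Then the following hold. (I) If $(n+2)s+(n-2)t > n \geq 3s-t$, then $\log B \geq \log A$; and if in addition $t-s \geq n$, then $B \geq A$. (II) If $(n+2)s+(n-2)t \leq n$, then $\log B \geq \log A$; and if in addition $t-s \geq n$, then $B \geq A$.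
   Context: For a bounded linear operator $T$ on a Hilbert space $\mathcal{H}$, $T \geq 0$ means that $T$ is a positive (semidefinite) operator, and $T > 0$ means that $T$ is positive and invertible. For self-adjoint operators $X, Y$, $X \geq Y$ means $X - Y \geq 0$. Real powers and logarithms of positive invertible operators are defined by the continuous functional calculus; the product inside the outer parentheses in the hypothesis is a positive invertible operator. *)

(* Defs.v *)
From HB Require Import structures.
From mathcomp Require Import all_boot all_order all_algebra complex.
From mathcomp Require Import all_classical all_reals all_analysis.

Set Implicit Arguments.
Unset Strict Implicit.
Unset Printing Implicit Defensive.

Import Order.TTheory GRing.Theory Num.Theory.
Import numFieldNormedType.Exports.

Local Open Scope classical_set_scope.
Local Open Scope ring_scope.
Local Open Scope complex_scope.

(* Complex Hilbert spaces: the inner product is linear in its first argument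
   and conjugate-linear in the second. *)
HB.mixin Record CompleteNormedModule_isHilbert (R : realType) H
    of CompleteNormedModule R[i] H := {
  inner : {dot H for Num.conj};
  inner_normE : forall x : H, `|x| ^+ 2 = inner x x
}.

#[short(type="hilbertType")]
HB.structure Definition Hilbert (R : realType) :=
  { H of CompleteNormedModule_isHilbert R H & CompleteNormedModule R[i] H }.

Definition bounded_operator (R : realType) (H : hilbertType R) (T : H -> H) :=
  linear T /\ exists M : R, forall x, `|T x| <= M%:C * `|x|.

Definition invertible_operator (R : realType) (H : hilbertType R)
    (T : H -> H) :=
  exists S : H -> H, [/\ bounded_operator S, cancel T S & cancel S T].

(* [0 <= z] in [R[i]] means that z is real and nonnegative, so, the scalars
   being complex, a positive bounded operator is self-adjoint. *)
Definition positive_operator (R : realType) (H : hilbertType R)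
    (T : H -> H) :=
  forall x, 0 <= inner (T x) x.

(* T > 0 *)
Definition positive_invertible (R : realType) (H : hilbertType R)
    (T : H -> H) :=
  [/\ bounded_operator T, positive_operator T & invertible_operator T].

(* X >= Y *)
Definition operator_ge (R : realType) (H : hilbertType R) (X Y : H -> H) :=
  positive_operator (X \- Y).

Definition spectrum (R : realType) (H : hilbertType R) (T : H -> H) :
    set R[i] :=
  [set l | ~ invertible_operator (fun x => T x - l *: x)].

Definition poly_operator (R : realType) (H : hilbertType R) (p : {poly R})
    (T : H -> H) : H -> H :=
  fun x => \sum_(k < size p) (p`_k)%:C *: iter k T x.

(* S = f(T) for T self-adjoint and f real-valued and continuous on the
   spectrum of T: S is the limit in operator norm of p(T) as the polynomial p
   tends to f uniformly on the spectrum. Only the real points of the spectrum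
   are tested, the spectrum of a self-adjoint operator being real. *)
Definition is_functional_calculus (R : realType) (H : hilbertType R)
    (f : R -> R) (T S : H -> H) :=
  forall e : R, 0 < e -> exists p : {poly R},
    (forall l : R, spectrum T l%:C -> `|p.[l] - f l| <= e) /\
    (forall x, `|poly_operator p T x - S x| <= e%:C * `|x|).

(* f(T), with the junk value 0 when there is no such operator. *)
Definition functional_calculus (R : realType) (H : hilbertType R)
    (f : R -> R) (T : H -> H) : H -> H :=
  xget (fun=> 0) [set S | is_functional_calculus f T S].

Definition operator_pow (R : realType) (H : hilbertType R) (T : H -> H)
    (r : R) : H -> H :=
  functional_calculus (fun l => l `^ r) T.

Definition operator_log (R : realType) (H : hilbertType R) (T : H -> H) :
    H -> H :=
  functional_calculus (@ln R) T.

(* Main.v *)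
Require Import Defs.
From HB Require Import structures.
From mathcomp Require Import all_boot all_order all_algebra complex cauchyreals.
From mathcomp Require Import all_classical all_reals all_analysis.
From mathcomp Require Import ring lra zify.

Set Implicit Arguments.
Unset Strict Implicit.
Unset Printing Implicit Defensive.

Import Order.TTheory GRing.Theory Num.Theory.
Local Open Scope ring_scope.

(* With [p = (t - s) / n], [X = B^(t/n) A^(-p) B^(t/n)] and
   [r = ((n + 2) s + (n - 2) t) / n = s + t - 2 p], the hypothesis reads
   [(B^(-p) X^n B^(-p))^(1/r) >= B]. If [r <= 1], the Loewner-Heinz inequality
   with exponent [r], conjugation by [B^p] and Loewner-Heinz with exponent
   [1/n] give [X >= B^((s+t)/n)]. If [r > 1], the same bound is the Furuta
   inequality for [(B^p C^r B^p)^(1/n)], where [C] is the left-hand side of the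
   hypothesis; its side condition [(1 + 2 p) n >= r + 2 p] is [n >= 3 s - t].
   Conjugating by [B^(-t/n)] gives [A^(-p) >= B^(-p)], that is [B^p >= A^p],
   hence the inequality of logarithms and, if [p >= 1], Loewner-Heinz with
   exponent [1/p] gives [B >= A]. *)

(** * Polynomial approximation *)

(** The functional calculus of the statement only asks for polynomials close to the function on the
    real spectrum, so each fact about powers and logarithms has to be drawn from polynomials in the
    operator. The spectral input is [pos_pe]: a real polynomial that is nonnegative at the real
    spectral values of a self-adjoint operator has a positive value there. Approximation then takes
    place on an interval [[m, M]] with [0 < m] that sandwiches the operator; powers and [ln] are
    Lipschitz on it, with explicit constants.

    The shift [p] comes from the ends of the product: [s / n = t / n - p], so each [B^(s/n)] is
    [B^(t/n)] times a spare [B^(-p)], and splitting [B^(2t/n)] into two equal factors regroups the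
    rest into [n] copies of [X]. The logarithm accepts any [p > 0] because [ln x] is the limit of
    [(x^h - 1) / h] as [h] tends to 0, so that arbitrarily small exponents are enough. *)

Section Approximation.
Variable R : realType.

(* The Bernstein polynomial [sum_k g k 'C(n, k) X^k (1 - X)^(n - k)], by
   conditioning on the first of [n] trials. *)
Fixpoint ber n (g : nat -> R) : {poly R} :=
  if n is n'.+1 then 'X * ber n' (g \o S) + (1 - 'X) * ber n' g
  else (g 0)%:P.

Lemma berS n g x : (ber n.+1 g).[x] =
  x * (ber n (g \o S)).[x] + (1 - x) * (ber n g).[x].
Proof. by rewrite /= !hornerE. Qed.

Lemma ber_le n f g x : 0 <= x <= 1 -> (forall k, f k <= g k) ->
  (ber n f).[x] <= (ber n g).[x].
Proof.
move=> /andP[x0 x1]; elim: n f g => [|n IHn] f g fg; first by rewrite !hornerC.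
have h1 := IHn f g fg; have h2 := IHn (f \o S) (g \o S) (fun k => fg k.+1).
by rewrite !berS lerD // ler_wpM2l // subr_ge0.
Qed.

Lemma berD n f g x : (ber n (fun k => f k + g k)).[x] = (ber n f).[x] + (ber n g).[x].
Proof.
elim: n f g => [|n IHn] f g; first by rewrite !hornerC.
by rewrite !berS (IHn (f \o S) (g \o S)) (IHn f g); ring.
Qed.

Lemma berZ n a f x : (ber n (fun k => a * f k)).[x] = a * (ber n f).[x].
Proof.
elim: n f => [|n IHn] f; first by rewrite !hornerC.
by rewrite !berS (IHn (f \o S)) (IHn f); ring.
Qed.

Lemma ber_cst n a x : (ber n (fun=> a)).[x] = a.
Proof.
elim: n => [|n IHn]; first by rewrite !hornerC.
by rewrite !berS (_ : (fun=> a) \o S = fun=> a) // IHn; ring.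
Qed.

(** Second moment of a binomial variable about [c]: squared bias plus variance. The centre [c] stays
    general because a success in the first trial turns it into [c - 1]. *)
Lemma ber_variance n c x : (ber n (fun k => (k%:R - c) ^+ 2)).[x] =
  (n%:R * x - c) ^+ 2 + n%:R * (x * (1 - x)).
Proof.
elim: n c => [|n IHn] c; first by rewrite !hornerC; ring.
have e : (fun k : nat => (k%:R - c) ^+ 2) \o S = (fun k => (k%:R - (c - 1)) ^+ 2).
  by apply/funext => k /=; rewrite -natr1; ring.
by rewrite berS e !IHn -natr1; ring.
Qed.

(* [L d <= e / 2 + (L ^ 2 / 2 e) d ^ 2], and the variance of the Bernstein
   weights at [x] is [x (1 - x) / n]. *)
Lemma weierstrass01 (f : R -> R) (L e : R) : 0 < e ->
  {in `[0, 1] &, forall x y, `|f x - f y| <= L * `|x - y|} ->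
  exists p : {poly R}, {in `[0, 1], forall x, `|p.[x] - f x| <= e}.
Proof.
move=> e0 fL; have [n nE] : exists n : nat, L ^+ 2 / e ^+ 2 < n.+1%:R.
  exists (Num.truncn (L ^+ 2 / e ^+ 2)).
  by have /truncn_itv/andP[] : 0 <= L ^+ 2 / e ^+ 2 by rewrite divr_ge0 ?sqr_ge0.
set N := n.+1 in nE; have N0 : 0 < N%:R :> R by [].
(* [ber_le] compares values at all [k], also beyond [N], so the nodes are clamped into [[0, 1]];
   clamping only brings a node closer to [x]. *)
pose g k := f (Num.min 1 (k%:R / N%:R)).
exists (ber N g) => x x01; have := x01; rewrite in_itv /= => /andP[x0 x1].
pose B k := e / 2 + L ^+ 2 / (2 * e * N%:R ^+ 2) * (k%:R - N%:R * x) ^+ 2.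
have gf k : `|g k - f x| <= B k.
  rewrite /B.
  have y0 : 0 <= k%:R / N%:R :> R by rewrite divr_ge0.
  have y01 : Num.min 1 (k%:R / N%:R) \in `[0 : R, 1].
    by rewrite in_itv /= le_min ler01 y0 ge_min lexx.
  apply: (le_trans (fL _ _ y01 x01)).
  have -> : L ^+ 2 / (2 * e * N%:R ^+ 2) * (k%:R - N%:R * x) ^+ 2 =
      L ^+ 2 / (2 * e) * (k%:R / N%:R - x) ^+ 2.
    by field; rewrite !gt_eqF.
  set y := k%:R / N%:R in y0 y01 *; set d := `|_|.
  have d2 : d ^+ 2 <= (y - x) ^+ 2.
    rewrite /d real_normK ?num_real // minEle; case: ifP => // y1.
    by rewrite ler_sqr ?nnegrE; lra.
  apply: (@le_trans _ _ (e / 2 + L ^+ 2 / (2 * e) * d ^+ 2)); last first.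
    by rewrite lerD2l ler_wpM2l // divr_ge0 ?sqr_ge0 // mulr_ge0 // ltW.
  rewrite -subr_ge0.
  have -> : e / 2 + L ^+ 2 / (2 * e) * d ^+ 2 - L * d =
      (e - L * d) ^+ 2 / (2 * e).
    by field; rewrite gt_eqF.
  by rewrite divr_ge0 ?sqr_ge0 // mulr_ge0 // ltW.
have BE : (ber N B).[x] <= e.
  have -> : (ber N B).[x] = e / 2 + L ^+ 2 / (2 * e * N%:R ^+ 2) * (N%:R * (x * (1 - x))).
    rewrite /B berD ber_cst; congr (_ + _).
    by rewrite (berZ N _ (fun k => (k%:R - N%:R * x) ^+ 2)) ber_variance subrr expr0n add0r.
  have -> : L ^+ 2 / (2 * e * N%:R ^+ 2) * (N%:R * (x * (1 - x))) =
     e / 2 * (L ^+ 2 / e ^+ 2) / N%:R * (x * (1 - x)).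
    by field; rewrite !gt_eqF.
  rewrite -[leRHS](subrK (e / 2)) addrC lerD2r.
  have -> : e - e / 2 = e / 2 by lra.
  have e2 : 0 < e / 2 by rewrite divr_gt0.
  have q0 : 0 <= L ^+ 2 / e ^+ 2 by rewrite divr_ge0 ?sqr_ge0.
  have h : e / 2 * (L ^+ 2 / e ^+ 2) / N%:R <= e / 2.
    by rewrite ler_pdivrMr // ler_pM2l // ltW.
  have h0 : 0 <= e / 2 * (L ^+ 2 / e ^+ 2) / N%:R by rewrite divr_ge0 // mulr_ge0 // ltW.
  apply: le_trans h; rewrite ler_piMr //; nra.
have gE : (ber N g).[x] - f x = (ber N (fun k => g k + (- f x))).[x].
  by rewrite berD ber_cst.
have gE' : f x - (ber N g).[x] = (ber N (fun k => (-1) * g k + f x)).[x].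
  by rewrite berD ber_cst berZ mulN1r addrC.
rewrite ler_norml gE lerNl -{1}gE opprB gE'; apply/andP; split;
  apply: le_trans BE; apply: ber_le => // k;
  by move: (gf k); rewrite ler_norml => /andP[]; lra.
Qed.

Lemma weierstrass (f : R -> R) (m M L e : R) : m < M -> 0 < e ->
  {in `[m, M] &, forall x y, `|f x - f y| <= L * `|x - y|} ->
  exists p : {poly R}, {in `[m, M], forall x, `|p.[x] - f x| <= e}.
Proof.
move=> mM e0 fL; have d0 : 0 < M - m by rewrite subr_gt0.
have h y : y \in `[0, 1] -> m + (M - m) * y \in `[m, M].
  by rewrite !in_itv /= => /andP[y0 y1]; apply/andP; split; nra.
have [|p hp] :=
  @weierstrass01 (fun y => f (m + (M - m) * y)) (L * (M - m)) e e0.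
- move=> x y x01 y01; apply: (le_trans (fL _ _ (h _ x01) (h _ y01))); rewrite -mulrA.
  have -> : m + (M - m) * x - (m + (M - m) * y) = (M - m) * (x - y) by ring.
  by rewrite normrM (gtr0_norm d0).
exists (p \Po ((M - m)^-1 *: ('X - m%:P))) => x xmM.
have yE : x = m + (M - m) * ((M - m)^-1 * (x - m)).
  by rewrite mulrA divff ?gt_eqF // mul1r addrC subrK.
rewrite horner_comp !hornerE {2}yE; apply: hp.
move: xmM; rewrite !in_itv /= => /andP[mx xM].
by rewrite mulrC ler_pdivlMr // ler_pdivrMr // mul0r mul1r subr_ge0 lerD2r mx.
Qed.

Lemma ln_lipschitz (m : R) : 0 < m ->
  {in `[m, +oo[ &, forall x y, `|ln x - ln y| <= m^-1 * `|x - y|}.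
Proof.
move=> m0; suff W x y : m <= y -> y <= x -> ln x - ln y <= m^-1 * (x - y).
  move=> x y; rewrite !in_itv /= !andbT => mx my.
  have [xy|/ltW xy] := leP y x.
    rewrite !ger0_norm ?subr_ge0 //; first exact: W.
    by rewrite ler_ln // posrE (lt_le_trans m0).
  rewrite distrC [`|x - y|]distrC !ger0_norm ?subr_ge0 //; first exact: W.
  by rewrite ler_ln // posrE (lt_le_trans m0).
move=> my yx; have y0 := lt_le_trans m0 my; have x0 := lt_le_trans y0 yx.
rewrite -ln_div ?posrE // -[x / y](subrK 1) addrC.
apply: (@le_trans _ _ (x / y - 1)).
  by apply: le_ln1Dx; rewrite ltrBrDl subrr divr_gt0.
have -> : x / y - 1 = y^-1 * (x - y) by field; rewrite gt_eqF.
by rewrite ler_wpM2r ?subr_ge0 // lef_pV2 ?posrE.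
Qed.

Lemma expR_lipschitz (K u v : R) : u <= K -> v <= K ->
  `|expR u - expR v| <= expR K * `|u - v|.
Proof.
suff W x y : x <= K -> y <= x -> expR x - expR y <= expR K * (x - y).
  move=> uK vK; have [xy|/ltW xy] := leP v u.
    by rewrite !ger0_norm ?subr_ge0 ?ler_expR //; exact: W.
  by rewrite distrC [`|u - v|]distrC !ger0_norm ?subr_ge0 ?ler_expR //; exact: W.
move=> xK yx; apply: (@le_trans _ _ (expR x * (x - y))); last first.
  by rewrite ler_wpM2r ?subr_ge0 // ler_expR.
have := expR_ge1Dx (y - x); rewrite -(ler_pM2l (expR_gt0 x)) -expRD subrKC.
by lra.
Qed.

(** The inequality [1 + v <= expR v] at [u] and [- u] places [expR u] between [1 + u] and
    [1 / (1 - u)], and [1 / (1 - u) - 1 - u = u^2 / (1 - u)] is at most [2 u^2] here. *)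
Lemma expR_quadratic (u : R) : `|u| <= 2^-1 -> `|expR u - 1 - u| <= 2 * u ^+ 2.
Proof.
move=> u2; have := expR_ge1Dx u; have := expR_ge1Dx (- u); rewrite expRN.
have := expR_gt0 u; set E := expR u => E0 h1 h2.
have h3 : (1 - u) * E <= 1.
  by rewrite -(ler_pM2r E0) mulVf ?gt_eqF // in h1.
move: u2; rewrite ler_norml => /andP[u2 u3].
rewrite ger0_norm; last lra.
nra.
Qed.

Lemma powRE (x r : R) : 0 < x -> x `^ r = expR (r * ln x).
Proof. by move=> x0; rewrite /powR gt_eqF. Qed.

Lemma ln_bounded (m M : R) : 0 < m ->
  exists2 K : R, 0 < K & {in `[m, M], forall x, `|ln x| <= K}.
Proof.
move=> m0; exists (`|ln m| + `|ln M| + 1); first by rewrite ltr_wpDl // addr_ge0.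
move=> x; rewrite in_itv /= => /andP[mx xM]; have x0 := lt_le_trans m0 mx.
have h1 : ln m <= ln x by rewrite ler_ln.
have h2 : ln x <= ln M by rewrite ler_ln // posrE (lt_le_trans x0).
have := ler_norm (ln M); have := ler_norm (- ln m); rewrite normrN => h3 h4.
have := normr_ge0 (ln M); have := normr_ge0 (ln m).
by rewrite ler_norml => ? ?; apply/andP; split; lra.
Qed.

Lemma powR_lipschitz (m M r : R) : 0 < m -> exists L : R,
  {in `[m, M] &, forall x y, `|x `^ r - y `^ r| <= L * `|x - y|}.
Proof.
move=> m0; have [K K0 lnK] := @ln_bounded m M m0.
exists (expR (`|r| * K) * `|r| * m^-1) => x y xmM ymM.
have gt0 z : z \in `[m, M] -> 0 < z by rewrite in_itv /= => /andP[/(lt_le_trans m0)].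
have inm z : z \in `[m, M] -> z \in `[m, +oo[ by rewrite !in_itv /= andbT => /andP[].
have le z : z \in `[m, M] -> r * ln z <= `|r| * K.
  by move=> zmM; rewrite (le_trans (ler_norm _)) // normrM ler_wpM2l // lnK.
rewrite !powRE ?gt0 //; apply: (le_trans (expR_lipschitz (le _ xmM) (le _ ymM))).
rewrite -!mulrA ler_wpM2l ?expR_ge0 // -mulrBr normrM ler_wpM2l //.
exact: ln_lipschitz (inm _ xmM) (inm _ ymM).
Qed.

Lemma powR_cont_exponent (m M a e : R) : 0 < m -> 0 < e ->
  exists2 d, 0 < d &
    forall b, `|a - b| <= d -> {in `[m, M], forall x, `|x `^ a - x `^ b| <= e}.
Proof.
move=> m0 e0; have [K K0 lnK] := @ln_bounded m M m0.
pose E := expR ((`|a| + 1) * K); have E0 : 0 < E by exact: expR_gt0.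
exists (Num.min 1 (e / (E * K))).
  by rewrite lt_min ltr01 divr_gt0 // mulr_gt0.
move=> b; rewrite le_min => /andP[ab1 abd] x xmM.
have x0 : 0 < x by move: xmM; rewrite in_itv /= => /andP[/(lt_le_trans m0)].
have le c : `|c| <= `|a| + 1 -> c * ln x <= (`|a| + 1) * K.
  move=> ca; rewrite (le_trans (ler_norm _)) // normrM ler_pM //; exact: lnK.
have ba : `|b| <= `|a| + 1.
  by have := ler_normD (b - a) a; rewrite subrK distrC => /le_trans; apply; rewrite addrC lerD2l.
have aa : `|a| <= `|a| + 1 by rewrite lerDl.
rewrite !powRE //; apply: (le_trans (expR_lipschitz (le _ aa) (le _ ba))).
rewrite -mulrBl normrM -/E.
have -> : e = E * (e / (E * K) * K) by field; rewrite !gt_eqF.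
by rewrite ler_wpM2l ?(ltW E0) // ler_pM // lnK.
Qed.

Lemma ln_limit (m M e : R) : 0 < m -> 0 < e ->
  exists2 d, 0 < d & forall h, 0 < h <= d ->
    {in `[m, M], forall x, `|h^-1 * (x `^ h - 1) - ln x| <= e}.
Proof.
move=> m0 e0; have [K K0 lnK] := @ln_bounded m M m0.
(* The first bound puts [h * ln x] in the range of [expR_quadratic]; the second makes the resulting
   error [2 h K^2] at most [e]. *)
exists (Num.min (2 * K)^-1 (e / (2 * K ^+ 2))).
  by rewrite lt_min invr_gt0 divr_gt0 ?mulr_gt0 // exprn_gt0.
move=> h /andP[h0]; rewrite le_min => /andP[hK hd] x xmM.
have x0 : 0 < x by move: xmM; rewrite in_itv /= => /andP[/(lt_le_trans m0)].
have lK := lnK x xmM.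
have -> : h^-1 * (x `^ h - 1) - ln x = h^-1 * (expR (h * ln x) - 1 - h * ln x).
  by rewrite powRE //; field; rewrite gt_eqF.
rewrite normrM (gtr0_norm (_ : 0 < h^-1)) ?invr_gt0 // mulrC ler_pdivrMr //.
have hl : `|h * ln x| <= h * K by rewrite normrM (gtr0_norm h0) ler_pM2l.
apply: (le_trans (expR_quadratic _)).
  apply: (le_trans hl); have -> : 2^-1 = (2 * K)^-1 * K :> R by field; rewrite gt_eqF.
  by rewrite ler_pM2r.
have : (h * ln x) ^+ 2 <= (h * K) ^+ 2.
  by rewrite -real_normK ?num_real // ler_sqr ?nnegrE ?mulr_ge0 // ltW.
move=> hh; apply: (@le_trans _ _ (2 * (h * K) ^+ 2)); first by rewrite ler_pM2l.
have : h * (h * (2 * K ^+ 2)) <= h * e.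
  by rewrite ler_pM2l // -ler_pdivlMr // mulr_gt0 // exprn_gt0.
by rewrite exprMn; lra.
Qed.

End Approximation.

(** * The ring of bounded operators *)

Section BoundedOperators.
Local Open Scope complex_scope.
Variables (R : realType) (H : hilbertType R).
Local Notation C := R[i].

(** The norm of [H] takes its values in [R[i]]; estimates are carried out on its real part, in the
    ordered field [R]. *)
Definition nrm (x : H) : R := complex.Re `|x|.

Lemma nrmE (x : H) : `|x| = (nrm x)%:C.
Proof. by rewrite /nrm RRe_real // ger0_real // normr_ge0. Qed.

Lemma nrm_ge0 x : 0 <= nrm x.
Proof. by rewrite -lecR -nrmE normr_ge0. Qed.

Lemma nrm0 : nrm 0 = 0.
Proof. by rewrite /nrm normr0. Qed.

Lemma nrm0_eq0 x : nrm x = 0 -> x = 0.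
Proof. by move=> x0; apply/normr0_eq0; rewrite nrmE x0. Qed.

Lemma nrmN x : nrm (- x) = nrm x.
Proof. by rewrite /nrm normrN. Qed.

Lemma ler_nrmD x y : nrm (x + y) <= nrm x + nrm y.
Proof. by rewrite -lecR rmorphD /= -!nrmE ler_normD. Qed.

Lemma nrmZ (a : C) x : nrm (a *: x) = complex.Re `|a| * nrm x.
Proof.
apply/complexI; rewrite -nrmE normrZ rmorphM /= -nrmE; congr (_ * _).
Qed.

(** The statement speaks of bare functions; bundling them makes composition a ring product, so that
    conjugations become ring identities. *)
Record bop := Bop { bop_fun :> H -> H; bopP : bounded_operator bop_fun }.

Lemma bounded_opP (T : H -> H) :
  linear T -> (exists M : R, forall x, nrm (T x) <= M * nrm x) ->
  bounded_operator T.
Proof.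
move=> lT [M bM]; split=> //; exists M => x.
by rewrite !nrmE -rmorphM /= lecR.
Qed.

Lemma bop_nrm (T : bop) : exists2 M : R, 0 < M & forall x, nrm (T x) <= M * nrm x.
Proof.
case: (bopP T) => _ [M bM]; exists (`|M| + 1).
  by rewrite ltr_wpDl.
move=> x; have := bM x; rewrite !nrmE -rmorphM /= lecR => /le_trans; apply.
rewrite ler_wpM2r ?nrm_ge0 //; have := ler_norm M; lra.
Qed.

Lemma bopE (S T : bop) : (forall x, S x = T x) -> S = T.
Proof.
case: S T => [S pS] [T pT] /= /funext eST; subst T.
by rewrite (Prop_irrelevance pS pT).
Qed.

Lemma bop_linear (T : bop) a x y : T (a *: x + y) = a *: T x + T y.
Proof. by case: (bopP T) => lT _; exact: lT. Qed.

Lemma bop0 (T : bop) : T 0 = 0.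
Proof. by have := bop_linear T (-1) 0 0; rewrite scaler0 addr0 scaleN1r addNr. Qed.

Lemma bopD (T : bop) x y : T (x + y) = T x + T y.
Proof. by rewrite -[x]scale1r bop_linear !scale1r. Qed.

Lemma bopZ (T : bop) a x : T (a *: x) = a *: T x.
Proof. by rewrite -[a *: x]addr0 bop_linear bop0 addr0. Qed.

Lemma bopN (T : bop) x : T (- x) = - T x.
Proof. by rewrite -[- x]scaleN1r bopZ scaleN1r. Qed.

HB.instance Definition _ := gen_eqMixin bop.
HB.instance Definition _ := gen_choiceMixin bop.

Fact zero_bounded : bounded_operator (fun=> 0 : H).
Proof.
apply: bounded_opP => [a x y|]; first by rewrite scaler0 addr0.
by exists 0 => x; rewrite nrm0 mul0r.
Qed.

Fact one_bounded : bounded_operator (fun x : H => x).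
Proof. by apply: bounded_opP => //; exists 1 => x; rewrite mul1r. Qed.

Fact add_bounded (S T : bop) : bounded_operator (fun x => S x + T x).
Proof.
apply: bounded_opP => [a x y|].
  by rewrite !bop_linear scalerDr addrACA.
have [M _ bM] := bop_nrm S; have [N _ bN] := bop_nrm T.
exists (M + N) => x; rewrite mulrDl.
by apply: (le_trans (ler_nrmD _ _)); rewrite lerD.
Qed.

Fact scale_bounded (a : C) (T : bop) : bounded_operator (fun x => a *: T x).
Proof.
apply: bounded_opP => [b x y|].
  by rewrite bop_linear scalerDr !scalerA mulrC.
have [M _ bM] := bop_nrm T; exists (complex.Re `|a| * M) => x.
rewrite nrmZ -mulrA ler_wpM2l //.
by rewrite -lecR RRe_real ?ger0_real ?normr_ge0.
Qed.

Fact mul_bounded (S T : bop) : bounded_operator (fun x => S (T x)).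
Proof.
apply: bounded_opP => [b x y|]; first by rewrite !bop_linear.
have [M M0 bM] := bop_nrm S; have [N _ bN] := bop_nrm T.
exists (M * N) => x; apply: (le_trans (bM _)).
by rewrite -mulrA ler_wpM2l // ltW.
Qed.

Definition bop_zero := Bop zero_bounded.
Definition bop_one := Bop one_bounded.
Definition bop_add S T := Bop (add_bounded S T).
Definition bop_scale a T := Bop (scale_bounded a T).
Definition bop_mul S T := Bop (mul_bounded S T).
Definition bop_opp T := bop_scale (-1) T.

Fact bop_addA : associative bop_add.
Proof. by move=> S T U; apply: bopE => x /=; rewrite addrA. Qed.
Fact bop_addC : commutative bop_add.
Proof. by move=> S T; apply: bopE => x /=; rewrite addrC. Qed.
Fact bop_add0 : left_id bop_zero bop_add.
Proof. by move=> S; apply: bopE => x /=; rewrite add0r. Qed.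
Fact bop_addN : left_inverse bop_zero bop_opp bop_add.
Proof. by move=> S; apply: bopE => x /=; rewrite scaleN1r addNr. Qed.

HB.instance Definition _ :=
  GRing.isZmodule.Build bop bop_addA bop_addC bop_add0 bop_addN.

Fact bop_mulA : associative bop_mul.
Proof. by move=> S T U; apply: bopE. Qed.
Fact bop_mul1 : left_id bop_one bop_mul.
Proof. by move=> S; apply: bopE. Qed.
Fact bop_mulr1 : right_id bop_one bop_mul.
Proof. by move=> S; apply: bopE. Qed.
Fact bop_mulDl : left_distributive bop_mul +%R.
Proof. by move=> S T U; apply: bopE. Qed.
Fact bop_mulDr : right_distributive bop_mul +%R.
Proof. by move=> S T U; apply: bopE => x /=; rewrite bopD. Qed.

(** A ring in which [1 = 0] is allowed, since [H] may be the zero space. *)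
HB.instance Definition _ := GRing.Zmodule_isPzRing.Build bop
  bop_mulA bop_mul1 bop_mulr1 bop_mulDl bop_mulDr.

Fact bop_scaleA a b (T : bop) : bop_scale a (bop_scale b T) = bop_scale (a * b) T.
Proof. by apply: bopE => x /=; rewrite scalerA. Qed.
Fact bop_scale1 : left_id 1 bop_scale.
Proof. by move=> T; apply: bopE => x /=; rewrite scale1r. Qed.
Fact bop_scaleDr : right_distributive bop_scale +%R.
Proof. by move=> a S T; apply: bopE => x /=; rewrite scalerDr. Qed.
Fact bop_scaleDl (T : bop) : {morph (fun a => bop_scale a T) : a b / a + b}.
Proof. by move=> a b; apply: bopE => x /=; rewrite scalerDl. Qed.

HB.instance Definition _ := GRing.Zmodule_isLmodule.Build C bop
  bop_scaleA bop_scale1 bop_scaleDr bop_scaleDl.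

Lemma bopDE (S T : bop) x : (S + T) x = S x + T x. Proof. by []. Qed.
Lemma bopNE (S : bop) x : (- S) x = - S x. Proof. exact: scaleN1r. Qed.
Lemma bopBE (S T : bop) x : (S - T) x = S x - T x.
Proof. by rewrite bopDE bopNE. Qed.
Lemma bop0E x : (0 : bop) x = 0. Proof. by []. Qed.
Lemma bop1E x : (1 : bop) x = x. Proof. by []. Qed.
Lemma bopME (S T : bop) x : (S * T) x = S (T x). Proof. by []. Qed.
Lemma bopZE a (S : bop) x : (a *: S) x = a *: S x. Proof. by []. Qed.
Definition bopRE := (bopDE, bopNE, bop0E, bop1E, bopME, bopZE).

Lemma bop_scaleAl a (S T : bop) : a *: (S * T) = (a *: S) * T.
Proof. by apply: bopE. Qed.
Lemma bop_scaleAr a (S T : bop) : a *: (S * T) = S * (a *: T).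
Proof. by apply: bopE => x; rewrite !bopRE bopZ. Qed.

Lemma bopX_iter (T : bop) n x : (T ^+ n) x = iter n T x.
Proof. by elim: n => [//|n IHn]; rewrite exprS bopME IHn. Qed.

Definition scal (a : R) : bop := a%:C *: (1 : bop).
Local Notation "a %:O" := (scal a) (at level 2, format "a %:O").

Lemma scalE a x : (a%:O) x = a%:C *: x. Proof. by []. Qed.

(** * Inner product, adjoints and quadratic forms *)

Definition ip (x y : H) : C := inner x y.

Lemma ipDl x y z : ip (x + y) z = ip x z + ip y z.
Proof. exact: linearDl. Qed.
Lemma ipDr x y z : ip z (x + y) = ip z x + ip z y.
Proof. exact: linearDr. Qed.
Lemma ipZl a x y : ip (a *: x) y = a * ip x y.
Proof. exact: linearZl_LR. Qed.
Lemma ipZr a x y : ip x (a *: y) = a^*%C * ip x y.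
Proof. exact: linearZr_LR. Qed.
Lemma ip0l x : ip 0 x = 0. Proof. by rewrite -(scale0r 0) ipZl mul0r. Qed.
Lemma ipC x y : ip x y = (ip y x)^*%C.
Proof. by rewrite /ip hermC expr0 mul1r. Qed.
Lemma ip0r x : ip x 0 = 0. Proof. by rewrite ipC ip0l conjc0. Qed.
Lemma ip_nrm x : ip x x = (nrm x ^+ 2)%:C.
Proof. by rewrite /ip -inner_normE nrmE rmorphXn. Qed.

(** A relation, established by exhibiting the adjoint: the operators met below are products of
    self-adjoint factors, whose adjoint is the reversed product. *)
Definition adjoint (S T : bop) := forall x y, ip (S x) y = ip x (T y).
Definition sa (T : bop) := adjoint T T.

Lemma adjointC S T : adjoint S T -> adjoint T S.
Proof. by move=> aST x y; rewrite ipC -aST -ipC. Qed.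

Lemma adjointM S S' T T' : adjoint S S' -> adjoint T T' -> adjoint (S * T) (T' * S').
Proof. by move=> aS aT x y; rewrite !bopME aS aT. Qed.

Lemma adjointD S S' T T' : adjoint S S' -> adjoint T T' -> adjoint (S + T) (S' + T').
Proof. by move=> aS aT x y; rewrite !bopDE ipDl ipDr aS aT. Qed.

Lemma adjointZ (a : R) S S' : adjoint S S' -> adjoint (a%:C *: S) (a%:C *: S').
Proof. by move=> aS x y; rewrite !bopZE ipZl ipZr aS conjc_real. Qed.

Lemma sa1 : sa 1. Proof. by move=> x y; rewrite bop1E. Qed.
Lemma sa0 : sa 0. Proof. by move=> x y; rewrite bop0E ip0l ip0r. Qed.
Lemma saZ (a : R) T : sa T -> sa (a%:C *: T). Proof. exact: adjointZ. Qed.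
Lemma saD S T : sa S -> sa T -> sa (S + T). Proof. exact: adjointD. Qed.
Lemma saN T : sa T -> sa (- T).
Proof. by move=> sT; rewrite -scaleN1r -(rmorphN1 (real_complex R)); apply: saZ. Qed.
Lemma saB S T : sa S -> sa T -> sa (S - T).
Proof. by move=> sS sT; apply: saD => //; apply: saN. Qed.
Lemma sa_scal a : sa a%:O. Proof. exact/saZ/sa1. Qed.
Lemma saX T n : sa T -> sa (T ^+ n).
Proof.
move=> sT; elim: n => [|n IHn]; first exact: sa1.
by rewrite /sa {2}exprS exprSr; apply: adjointM.
Qed.
Lemma sa_adjM S S' T : adjoint S S' -> sa T -> sa (S * T * S').
Proof.
move=> aS sT; have := adjointM (adjointM aS sT) (adjointC aS).
by rewrite mulrA.
Qed.

Definition qf (T : bop) x : R := complex.Re (ip (T x) x).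

Lemma qfE T x : sa T -> ip (T x) x = (qf T x)%:C.
Proof.
move=> sT; rewrite /qf RRe_real // CrealE; apply/eqP.
by have := ipC x (T x); rewrite -sT => /esym.
Qed.
Lemma qf1 x : qf 1 x = nrm x ^+ 2.
Proof. by rewrite /qf bop1E ip_nrm. Qed.
Lemma qfD S T x : qf (S + T) x = qf S x + qf T x.
Proof. by rewrite /qf bopDE ipDl raddfD. Qed.
Lemma qfZ (a : R) T x : qf (a%:C *: T) x = a * qf T x.
Proof.
by rewrite /qf bopZE ipZl; case: (ip _ _) => u v /=; rewrite mul0r subr0.
Qed.
Lemma qfN T x : qf (- T) x = - qf T x.
Proof. by rewrite -scaleN1r -(rmorphN1 (real_complex R)) qfZ mulN1r. Qed.
Lemma qfB S T x : qf (S - T) x = qf S x - qf T x.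
Proof. by rewrite qfD qfN. Qed.
Lemma qf_scal a x : qf a%:O x = a * nrm x ^+ 2.
Proof. by rewrite qfZ qf1. Qed.
Lemma qf_adjM S S' T x : adjoint S S' -> qf (S' * T * S) x = qf T (S x).
Proof. by move=> /adjointC aS; rewrite /qf !bopME aS. Qed.
Lemma qf_adj S S' x : adjoint S S' -> qf (S' * S) x = nrm (S x) ^+ 2.
Proof. by move=> aS; rewrite -[S']mulr1 (qf_adjM _ _ aS) qf1. Qed.

(** Self-adjointness is stated apart because [qf] only sees the real part of the form. *)
Definition pos (T : bop) := sa T /\ forall x, 0 <= qf T x.

(* Self-adjointness follows by polarization, the scalars being complex. *)
Lemma posP (T : bop) : positive_operator T <-> pos T.
Proof.
split=> [pT|[sT qT] x]; last by rewrite -/(ip _ _) (qfE _ sT) lecR.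
have iT x : complex.Im (ip (T x) x) = 0.
  have := pT x; rewrite -/(ip _ _); case: (ip _ _) => u v /=.
  by rewrite lecE /= => /andP[/eqP].
split=> [x y|x]; last first.
  have := pT x; rewrite -/(ip _ _) /qf; case: (ip _ _) => u v /=.
  by rewrite lecE /= => /andP[].
(* The first vanishing imaginary part gives the imaginary part of the wanted equality, the second
   its real part. *)
have := iT (x + y); have := iT ('i%C *: x + y).
rewrite !bopD bopZ !(ipDl, ipDr, ipZl, ipZr) !raddfD /= (iT y).
rewrite [ip x (T y)]ipC; have := iT x.
case: (ip (T x) x) (ip (T x) y) (ip (T y) x) => [u v] [u1 v1] [u2 v2] /=.
move=> v0 h1 h2; congr Complex; lra.
Qed.
End BoundedOperators.

Local Notation "a %:O" := (scal _ a) (at level 2, format "a %:O").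

(** * Operator order, norm bounds and completeness *)

Section OperatorOrder.
Import numFieldNormedType.Exports.
Local Open Scope classical_set_scope.
Local Open Scope ring_scope.
Local Open Scope complex_scope.
Variables (R : realType) (H : hilbertType R).
Local Notation C := R[i].
Local Notation bop := (bop H).
Implicit Types S T U : bop.

Definition ople (S T : bop) := pos (T - S).
Local Notation "S <=o T" := (ople S T) (at level 70).

Lemma scalM (a : R) T : a%:O * T = a%:C *: T.
Proof. by rewrite -bop_scaleAl mul1r. Qed.

Lemma mulScal (a : R) T : T * a%:O = a%:C *: T.
Proof. by rewrite -bop_scaleAr mulr1. Qed.

Lemma scalMscal (a b : R) : a%:O * b%:O = (a * b)%:O :> bop.
Proof. by rewrite scalM /scal scalerA -rmorphM. Qed.

Lemma scalD (a b : R) : a%:O + b%:O = (a + b)%:O :> bop.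
Proof. by rewrite /scal rmorphD scalerDl. Qed.

Lemma pos0 : pos (0 : bop).
Proof. by split=> [|x]; [exact: sa0 | rewrite /qf bop0E ip0l]. Qed.

Lemma posD S T : pos S -> pos T -> pos (S + T).
Proof.
move=> [sS qS] [sT qT]; split=> [|x]; first exact: saD.
by rewrite qfD addr_ge0.
Qed.

Lemma posZ (a : R) (T : bop) : 0 <= a -> pos T -> pos (a%:C *: T).
Proof.
move=> a0 [sT qT]; split=> [|x]; first exact: saZ.
by rewrite qfZ mulr_ge0.
Qed.

Lemma pos_adj (S S' T : bop) : adjoint S S' -> pos T -> pos (S' * T * S).
Proof.
move=> aS [sT qT]; split=> [|x]; last by rewrite (qf_adjM _ _ aS).
exact/sa_adjM/sT/adjointC.
Qed.

Lemma ople_refl T : T <=o T.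
Proof. by rewrite /ople subrr; exact: pos0. Qed.

Lemma ople_trans S T U : S <=o T -> T <=o U -> S <=o U.
Proof. by move=> ST TU; have := posD ST TU; rewrite addrC subrKA. Qed.

Lemma ople_adj (S S' T U : bop) :
  adjoint S S' -> T <=o U -> S' * T * S <=o S' * U * S.
Proof. by move=> aS /(pos_adj aS); rewrite mulrBr mulrBl. Qed.

Lemma opleZ (a : R) S T : 0 <= a -> S <=o T -> a%:C *: S <=o a%:C *: T.
Proof. by move=> a0 /(posZ a0); rewrite scalerBr. Qed.

Lemma ople_scal (a b : R) : a <= b -> a%:O <=o b%:O.
Proof.
move=> ab; split=> [|x]; first by apply: saB; exact: sa_scal.
by rewrite qfB !qf_scal -mulrBl mulr_ge0 ?subr_ge0 // exprn_ge0 ?nrm_ge0.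
Qed.

Lemma ople_scalP (a : R) T : sa T -> (forall x, a * nrm x ^+ 2 <= qf T x) -> a%:O <=o T.
Proof.
move=> sT aT; split=> [|x]; first by apply: saB => //; exact: sa_scal.
by rewrite qfB qf_scal subr_ge0.
Qed.

Lemma ople_Pscal (a : R) T : sa T -> (forall x, qf T x <= a * nrm x ^+ 2) -> T <=o a%:O.
Proof.
move=> sT aT; split=> [|x]; first by apply: saB => //; exact: sa_scal.
by rewrite qfB qf_scal subr_ge0.
Qed.

Lemma ople_qf S T x : S <=o T -> qf S x <= qf T x.
Proof. by move=> [_ /(_ x)]; rewrite qfB subr_ge0. Qed.

Lemma ople_pos S T : pos S -> S <=o T -> pos T.
Proof. by move=> pS ST; have := posD ST pS; rewrite subrK. Qed.

Lemma scal_pos (a : R) : 0 <= a -> pos (a%:O : bop).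
Proof.
move=> /ople_scal; apply: ople_pos; rewrite /scal scale0r; exact: pos0.
Qed.

Lemma ople_scal_sa a T : a%:O <=o T -> sa T.
Proof. by move=> [sT _]; have := saD sT (@sa_scal _ _ a); rewrite subrK. Qed.

Definition bnd (T : bop) (c : R) := forall x, nrm (T x) <= c * nrm x.

Lemma bnd_eq0 T : (forall e, 0 < e -> bnd T e) -> T = 0.
Proof.
move=> bT; apply: bopE => x; apply: nrm0_eq0; apply/eqP.
rewrite eq_le nrm_ge0 andbT; apply/ler_addgt0Pr => e e0; rewrite add0r.
have x0 := nrm_ge0 x.
have d0 : 0 < e / (nrm x + 1) by rewrite divr_gt0 // ltr_wpDl.
apply: (le_trans (bT _ d0 x)).
by rewrite mulrAC ler_pdivrMr ?ltr_wpDl // ler_pM2l // lerDl.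
Qed.

Lemma bnd_le T c d : c <= d -> bnd T c -> bnd T d.
Proof. by move=> cd bT x; apply: (le_trans (bT x)); rewrite ler_wpM2r ?nrm_ge0. Qed.

Lemma bndD S T c d : bnd S c -> bnd T d -> bnd (S + T) (c + d).
Proof.
move=> bS bT x; rewrite bopDE mulrDl; apply: (le_trans (ler_nrmD _ _)).
by rewrite lerD.
Qed.

Lemma bndN S c : bnd S c -> bnd (- S) c.
Proof. by move=> bS x; rewrite bopNE nrmN. Qed.

Lemma bndB S T c d : bnd S c -> bnd T d -> bnd (S - T) (c + d).
Proof. by move=> bS /bndN; exact: bndD. Qed.

Lemma bnd_sym S T c : bnd (S - T) c -> bnd (T - S) c.
Proof. by move=> /bndN; rewrite opprB. Qed.

Lemma bndM S T c d : 0 <= c -> bnd S c -> bnd T d -> bnd (S * T) (c * d).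
Proof.
move=> c0 bS bT x; rewrite bopME; apply: (le_trans (bS _)).
by rewrite -mulrA ler_wpM2l.
Qed.

Lemma bnd1 : bnd 1 1. Proof. by move=> x; rewrite bop1E mul1r. Qed.

Lemma bnd0 : bnd 0 0. Proof. by move=> x; rewrite bop0E nrm0 mul0r. Qed.

Lemma bndX T c n : 0 <= c -> bnd T c -> bnd (T ^+ n) (c ^+ n).
Proof.
move=> c0 bT; elim: n => [|n IHn]; first exact: bnd1.
by rewrite !exprS; apply: bndM.
Qed.

Lemma bnd_exists T : exists2 c, 0 < c & bnd T c.
Proof. exact: bop_nrm. Qed.

(** Expanding [0 <= |(T - a) x|^2] at [a = c] and [a = - c], with [|T x| <= c |x|], bounds the form
    by [c |x|^2] on both sides. *)
Lemma bnd_ople T c : 0 < c -> sa T -> bnd T c -> (- c)%:O <=o T /\ T <=o c%:O.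
Proof.
move=> c0 sT bT.
have qT x : nrm (T x) ^+ 2 <= c ^+ 2 * nrm x ^+ 2.
  by rewrite -exprMn ler_sqr ?nnegrE ?mulr_ge0 ?nrm_ge0 // ltW.
have sc a : sa (T - a%:O) by apply: saB => //; exact: sa_scal.
have q a x : 0 <= nrm (T x) ^+ 2 - 2 * a * qf T x + a ^+ 2 * nrm x ^+ 2.
  have := sqr_ge0 (nrm ((T - a%:O) x)).
  rewrite -(qf_adj _ (sc a)) mulrBl !mulrBr !qfB mulScal !scalM !qfZ qf1.
  by rewrite (qf_adj _ sT); lra.
split; [apply: ople_scalP | apply: ople_Pscal] => // x.
- have := q (- c) x; have := qT x; nra.
- have := q c x; have := qT x; nra.
Qed.

(** Converse of [bnd_ople]. This direction turns the positivity of polynomials in [T] into norm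
    estimates, hence into convergence. *)
Lemma ople_bnd T c : 0 < c -> (- c)%:O <=o T -> T <=o c%:O -> bnd T c.
Proof.
move=> c0 cT Tc; have sT := ople_scal_sa cT.
have s1 : sa (c%:O + T) by apply: saD => //; exact: sa_scal.
have p1 : pos (c%:O + T).
  by move: cT; rewrite /ople /scal rmorphN scaleNr opprK addrC.
have p2 : pos (c%:O - T) by [].
have s2 := p2.1.
(* [(c - T)(c + T)(c - T) + (c + T)(c - T)(c + T) = 2 c (c ^ 2 - T ^ 2)] *)
have p3 : pos ((c%:O - T) * (c%:O + T) * (c%:O - T) +
    (c%:O + T) * (c%:O - T) * (c%:O + T)).
  by apply: posD; apply: pos_adj.
have e : (c%:O - T) * (c%:O + T) * (c%:O - T) +
    (c%:O + T) * (c%:O - T) * (c%:O + T) = (2 * c)%:C *: ((c ^+ 2)%:O - T * T).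
  have -> : (c%:O - T) * (c%:O + T) = (c ^+ 2)%:O - T * T.
    by rewrite mulrBl !mulrDr scalM mulScal scalM opprD addrA addrK -scalM scalMscal.
  have -> : (c%:O + T) * (c%:O - T) = (c ^+ 2)%:O - T * T.
    by rewrite mulrDl !mulrBr scalM mulScal scalM addrA subrK -scalM scalMscal.
  rewrite -mulrDr addrACA addNr addr0 scalD mulScal.
  by rewrite mulr2n mulrDl mul1r.
rewrite e in p3.
move=> x; have := p3.2 x; rewrite qfZ pmulr_rge0; last by rewrite mulr_gt0.
rewrite qfB qf_scal (qf_adj _ sT) subr_ge0 -exprMn ler_sqr ?nnegrE ?nrm_ge0 //.
by rewrite mulr_ge0 ?nrm_ge0 // ltW.
Qed.

Lemma bop_complete (T_ : nat -> bop) :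
  (forall e, 0 < e -> exists N, forall i j, (N <= i)%N -> (N <= j)%N ->
     bnd (T_ i - T_ j) e) ->
  exists S, forall e, 0 < e -> exists N, forall i, (N <= i)%N -> bnd (T_ i - S) e.
Proof.
move=> T_c.
have cv x : exists y, forall d, 0 < d ->
    exists N, forall i, (N <= i)%N -> nrm (T_ i x - y) <= d.
  have : cvg (T_ ^~ x @ \oo).
    apply/cauchy_cvgP/cauchy_exP => e e0.
    have eE : e = (complex.Re e)%:C by rewrite RRe_real ?gtr0_real.
    have e0' : 0 < complex.Re e by rewrite -ltcR -eE.
    have x0 := nrm_ge0 x.
    have [|N hN] := T_c (complex.Re e / (nrm x + 1)).
      by rewrite divr_gt0 // ltr_wpDl.
    exists (T_ N x); exists N => // i /= Ni; rewrite -ball_normE /= nrmE eE ltcR -bopBE.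
    apply: (le_lt_trans (hN _ _ (leqnn N) Ni x)).
    by rewrite mulrAC ltr_pdivrMr ?ltr_wpDl // ltr_pM2l // ltrDl.
  move=> /cvg_ex[y /cvgrPdist_le yx]; exists y => d d0.
  have [|N _ hN] := yx d%:C; first by rewrite ltcR.
  by exists N => i Ni; have := hN i Ni; rewrite nrmE lecR -nrmN opprB.
pose s x := projT1 (cid (cv x)).
have sE x d : 0 < d -> exists N, forall i, (N <= i)%N -> nrm (T_ i x - s x) <= d.
  by rewrite /s; case: cid => y /= hy; exact: hy.
have s_lin : linear s.
  move=> a x y; apply/eqP; rewrite -subr_eq0; apply/eqP; apply: nrm0_eq0.
  apply/eqP; rewrite eq_le nrm_ge0 andbT; apply/ler_addgt0Pr => e e0; rewrite add0r.
  have na0 : 0 <= complex.Re `|a| by rewrite -lecR RRe_real ?ger0_real ?normr_ge0.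
  have d0 : 0 < e / (complex.Re `|a| + 2) by rewrite divr_gt0 // ltr_wpDl.
  have [N1 h1] := sE (a *: x + y) _ d0; have [N2 h2] := sE x _ d0.
  have [N3 h3] := sE y _ d0; pose N := maxn N1 (maxn N2 N3).
  have {h1} := h1 N (leq_maxl _ _); rewrite bop_linear => h1.
  have {}h2 := h2 N (leq_trans (leq_maxl _ _) (leq_maxr _ _)).
  have {}h3 := h3 N (leq_trans (leq_maxr _ _) (leq_maxr _ _)).
  have -> : s (a *: x + y) - (a *: s x + s y) =
    - (a *: T_ N x + T_ N y - s (a *: x + y)) + (a *: (T_ N x - s x) + (T_ N y - s y)).
    by rewrite scalerBr opprB [X in _ = _ + X]addrACA -opprD subrKA.
  apply: (le_trans (ler_nrmD _ _)); rewrite nrmN.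
  apply: (le_trans (lerD h1 (ler_nrmD _ _))); rewrite nrmZ.
  have := ler_wpM2l na0 h2; set d := e / _ in d0 h1 h2 h3 *.
  have <- : d * (complex.Re `|a| + 2) = e by rewrite divfK // gt_eqF // ltr_wpDl.
  lra.
(* Letting [j] tend to infinity in the Cauchy estimate makes the pointwise limit [s] uniform on
   bounded sets. *)
have s_lim e N : 0 < e -> (forall i j, (N <= i)%N -> (N <= j)%N -> bnd (T_ i - T_ j) e) ->
    forall i, (N <= i)%N -> forall x, nrm (T_ i x - s x) <= e * nrm x.
  move=> e0 hN i Ni x; apply/ler_addgt0Pr => d d0; have [M hM] := sE x d d0.
  rewrite -(subrKA (T_ (maxn N M) x)); apply: (le_trans (ler_nrmD _ _)).
  by rewrite -bopBE; apply: lerD; [exact/hN/leq_maxl | exact/hM/leq_maxr].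
have [N hN] := T_c 1 ltr01.
have s_bnd : bounded_operator s.
  apply: bounded_opP => //; have [c _ hc] := bop_nrm (T_ N).
  exists (1 + c) => x; rewrite -[s x](subrK (T_ N x)) mulrDl.
  apply: (le_trans (ler_nrmD _ _)); apply: lerD => //.
  by rewrite -nrmN opprB; exact: (s_lim 1 N ltr01 hN).
exists (Bop s_bnd) => e e0; have [M hM] := T_c e e0.
by exists M => i Mi x; rewrite bopBE; exact: (s_lim e M e0 hM).
Qed.

Definition opinv T := exists S, T * S = 1 /\ S * T = 1.

End OperatorOrder.

Local Notation "S <=o T" := (ople S T) (at level 70).

(** * Spectral positivity *)

Section SpectralPositivity.
Import numFieldNormedType.Exports.
Local Open Scope classical_set_scope.
Local Open Scope ring_scope.
Local Open Scope complex_scope.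
Variables (R : realType) (H : hilbertType R).
Local Notation C := R[i].
Local Notation bop := (bop H).
Implicit Types S T U : bop.

Lemma invM S T : opinv S -> opinv T -> opinv (S * T).
Proof.
move=> [S' [SS' S'S]] [T' [TT' T'T]]; exists (T' * S'); split.
- by rewrite -mulrA (mulrA T) TT' mul1r.
- by rewrite -mulrA (mulrA S') S'S mul1r.
Qed.

Lemma comm_opinv S T U : S * U = 1 -> U * S = 1 -> T * S = S * T -> T * U = U * T.
Proof.
move=> SU US TS; rewrite -[T * U]mul1r -US -[RHS]mulr1 -SU -!mulrA.
by congr (_ * _); rewrite !mulrA TS.
Qed.

(** [T] commutes with the inverse [U] of [S * T], so [T * U] inverts [S] on both sides. It isolates
    one factor of [(T - z)(T - w)] in [inv_nonreal]. *)
Lemma inv_factor S T : S * T = T * S -> opinv (S * T) -> opinv S.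
Proof.
move=> ST [U [STU UST]]; exists (T * U); split; first by rewrite mulrA.
have -> : T * U = U * T by apply: (comm_opinv STU UST); rewrite {2}ST mulrA.
by rewrite -mulrA -ST.
Qed.

Lemma inv1 : opinv (1 : bop). Proof. by exists 1; rewrite mulr1. Qed.

Lemma invZ (a : C) T : a != 0 -> opinv T -> opinv (a *: T).
Proof.
move=> a0 [S [TS ST]]; exists (a^-1 *: S).
rewrite -!bop_scaleAl -!bop_scaleAr TS ST !scalerA mulVf ?divff //.
by rewrite scale1r.
Qed.

Lemma invZ_inv (a : C) T : opinv (a *: T) -> opinv T.
Proof.
have [-> [S []]|a0] := eqVneq a 0; last first.
  by move=> /(@invZ a^-1); rewrite scalerA mulVf // scale1r; apply; rewrite invr_eq0.
(* If [0] is invertible then [1 = 0], all operators coincide, and [0] is an inverse of anything. *)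
rewrite scale0r mul0r => T0 _; have e U : U = 0 by rewrite -[U]mulr1 -T0 mulr0.
by exists 0; rewrite (e 1) (e T) mulr0.
Qed.

Lemma expr_small (c e : R) : 0 <= c < 1 -> 0 < e ->
  exists N, forall n, (N <= n)%N -> c ^+ n <= e.
Proof.
move=> /andP[c0 c1] e0.
have : c ^+ n @[n --> \oo] --> (0 : R) by apply: cvg_expr; rewrite ger0_norm.
move=> /cvgrPdist_le/(_ e e0)[N _ hN]; exists N => n Nn.
by have := hN n Nn; rewrite sub0r normrN ger0_norm // exprn_ge0.
Qed.

Lemma inv_neumann (K : bop) (c : R) : 0 <= c < 1 -> bnd K c -> opinv (1 - K).
Proof.
move=> c01 bK; have /andP[c0 c1] := c01; have c1' : 0 < 1 - c by lra.
pose T_ n := \sum_(i < n) K ^+ i.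
have T_S n : T_ n.+1 = T_ n + K ^+ n by rewrite /T_ big_ord_recr.
(* The exact sum of the geometric tail, rather than the bound [c ^+ j / (1 - c)], is what the
   induction on [d] carries through. *)
have bT j d : bnd (T_ (d + j)%N - T_ j) ((c ^+ j - c ^+ (d + j)) / (1 - c)).
  elim: d => [|d IHd]; first by rewrite !subrr mul0r; exact: bnd0.
  rewrite addSn T_S addrAC.
  have -> : (c ^+ j - c ^+ (d + j).+1) / (1 - c) =
            (c ^+ j - c ^+ (d + j)) / (1 - c) + c ^+ (d + j).
    by rewrite exprS; field; rewrite gt_eqF.
  exact/bndD/bndX.
have [S hS] : exists S, forall e, 0 < e -> exists N, forall i, (N <= i)%N -> bnd (T_ i - S) e.
  apply: bop_complete => e e0.
  have [|N hN] := @expr_small c (e * (1 - c)) c01; first exact: mulr_gt0.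
  have W i j : (N <= i)%N -> (i <= j)%N -> bnd (T_ j - T_ i) e.
    move=> Ni ij; have := bT i (j - i)%N; rewrite subnK //; apply: bnd_le.
    rewrite ler_pdivrMr //; apply: le_trans (hN i Ni).
    by rewrite gerBl exprn_ge0.
  exists N => i j Ni Nj; have [ij|/ltnW ij] := leqP i j; last exact: W.
  exact/bnd_sym/W.
have lT n : (1 - K) * T_ n = 1 - K ^+ n.
  elim: n => [|n IHn]; first by rewrite /T_ big_ord0 mulr0 expr0 subrr.
  by rewrite T_S mulrDr IHn mulrBl mul1r -exprS addrA subrK.
have rT n : T_ n * (1 - K) = 1 - K ^+ n.
  elim: n => [|n IHn]; first by rewrite /T_ big_ord0 mul0r expr0 subrr.
  by rewrite T_S mulrDl IHn mulrBr mulr1 -exprSr addrA subrK.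
have [k k0 hk] := bnd_exists (1 - K).
have small e : 0 < e -> exists n,
    [/\ 0 < e / (2 * k), bnd (S - T_ n) (e / (2 * k)) & bnd (K ^+ n) (e / 2)].
  move=> e0; have e1 : 0 < e / (2 * k) by rewrite divr_gt0 // mulr_gt0.
  have e2 : 0 < e / 2 by rewrite divr_gt0.
  have [N1 h1] := hS _ e1; have [N2 h2] := expr_small c01 e2.
  exists (maxn N1 N2); split=> //; first exact/bnd_sym/h1/leq_maxl.
  exact/(bnd_le (h2 _ (leq_maxr _ _)))/bndX.
have ee e : e = k * (e / (2 * k)) + e / 2 by field; rewrite gt_eqF.
exists S; split; apply/eqP; rewrite -subr_eq0; apply/eqP/bnd_eq0 => e /small[n [e1 bS bKn]].
- have -> : (1 - K) * S - 1 = (1 - K) * (S - T_ n) - K ^+ n.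
    by rewrite mulrBr lT opprB addrA addrAC addrK.
  rewrite [e]ee; apply: bndB => //; apply: bndM => //; exact: ltW.
- have -> : S * (1 - K) - 1 = (S - T_ n) * (1 - K) - K ^+ n.
    by rewrite [(S - _) * _]mulrBl rT opprB addrA addrAC addrK.
  rewrite [e]ee [k * _]mulrC; apply: bndB => //; apply: bndM => //; exact: ltW.
Qed.

(** Neumann series for [T / M = 1 - K], where [M] is an upper bound of [T] and [K] has norm at most
    [1 - m / M]. *)
Lemma inv_ge (m : R) T : 0 < m -> m%:O <=o T -> opinv T.
Proof.
move=> m0 mT; have sT := ople_scal_sa mT.
have [M0 M00 /(bnd_ople M00 sT)[_ TM0]] := bnd_exists T.
(* Adding [m] to the norm bound forces [m / M < 1], so the bound on [K] is positive, as [ople_bnd]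
   requires. *)
pose M := M0 + m; have M_gt0 : 0 < M by rewrite addr_gt0.
have TM : T <=o M%:O by apply: (ople_trans TM0); apply: ople_scal; rewrite lerDl ltW.
have c0 : 0 < 1 - m / M by rewrite subr_gt0 ltr_pdivrMr // mul1r ltrDr.
pose K := 1 - (M^-1)%:C *: T.
have bK : bnd K (1 - m / M).
  have s1 : sa K by apply: saB; [exact: sa1 | exact: saZ].
  apply: ople_bnd => //; [apply: ople_scalP | apply: ople_Pscal] => // x; rewrite qfB qfZ qf1.
  - have := ople_qf x TM; rewrite qf_scal.
    rewrite -(ler_pM2l (_ : 0 < M^-1)) ?invr_gt0 // mulrA mulVf ?gt_eqF // mul1r.
    have := sqr_ge0 (nrm x); nra.
  - have := ople_qf x mT; rewrite qf_scal.
    rewrite -(ler_pM2l (_ : 0 < M^-1)) ?invr_gt0 //.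
    rewrite mulrBl mul1r; lra.
have : opinv (1 - K).
  apply: inv_neumann bK; rewrite ltW //= gtrBl; exact: divr_gt0.
rewrite opprB addrC subrK; exact: invZ_inv.
Qed.

(** From [0 <= Q <= k] the norm of [Q - k / 2] is at most [k / 2]; expanding the square of that
    bound leaves [Q^2 <= k Q]. *)
Lemma pos_sqr_le (Q : bop) k x : 0 < k -> pos Q -> Q <=o k%:O ->
  nrm (Q x) ^+ 2 <= k * qf Q x.
Proof.
move=> k0 pQ Qk; have s1 : sa (Q - (k / 2)%:O) by apply: saB; [exact: pQ.1 | exact: sa_scal].
have b1 : bnd (Q - (k / 2)%:O) (k / 2).
  apply: ople_bnd; first exact: divr_gt0.
    by rewrite /ople /scal rmorphN scaleNr opprK subrK.
  by rewrite /ople opprB addrA scalD -splitr.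
have : nrm ((Q - (k / 2)%:O) x) ^+ 2 <= (k / 2) ^+ 2 * nrm x ^+ 2.
  by rewrite -exprMn ler_sqr ?nnegrE ?mulr_ge0 ?nrm_ge0 //; exact: ltW.
rewrite -(qf_adj _ s1) mulrBl !mulrBr !qfB mulScal !scalM !qfZ qf1.
by rewrite (qf_adj _ pQ.1); lra.
Qed.

(** The inverse bounds [|x|] by [s |Q x|], and [pos_sqr_le] passes from [|Q x|^2] to the quadratic
    form. *)
Lemma pos_opinv_ge (Q : bop) : pos Q -> opinv Q -> exists2 d : R, 0 < d & d%:O <=o Q.
Proof.
move=> pQ [S [QS SQ]]; have [k k0 /(bnd_ople k0 pQ.1)[_ Qk]] := bnd_exists Q.
have [s s0 bS] := bnd_exists S.
have sk0 : 0 < s ^+ 2 * k by rewrite mulr_gt0 // exprn_gt0.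
exists (s ^+ 2 * k)^-1; first by rewrite invr_gt0.
apply: ople_scalP pQ.1 _ => x.
rewrite mulrC ler_pdivrMr // mulrC -mulrA.
have xS : nrm x <= s * nrm (Q x) by have := bS (Q x); rewrite -bopME SQ.
apply: (@le_trans _ _ (s ^+ 2 * nrm (Q x) ^+ 2)).
  by rewrite -exprMn ler_sqr ?nnegrE ?mulr_ge0 ?nrm_ge0 // ltW.
by rewrite ler_wpM2l ?sqr_ge0 //; exact: pos_sqr_le.
Qed.

(* The infimum of the numerical range is a spectral value. *)
Lemma spectrum_bottom T : sa T -> (exists x : H, x != 0) ->
  exists m : R, m%:O <=o T /\ ~ opinv (T - m%:O).
Proof.
move=> sT [x0 x0_neq0]; pose E := [set a : R | a%:O <=o T].
have nrm_gt0 x : x != 0 -> 0 < nrm x.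
  by move=> xn0; rewrite lt_neqAle nrm_ge0 eq_sym andbT; apply: contra_neq xn0; exact: nrm0_eq0.
have ubE x : x != 0 -> ubound E (qf T x / nrm x ^+ 2).
  move=> xn0 a /(ople_qf x); rewrite qf_scal ler_pdivlMr //.
  by rewrite exprn_gt0 // nrm_gt0.
have E0 : E !=set0.
  by have [c c0 /(bnd_ople c0 sT)[cT _]] := bnd_exists T; exists (- c).
have hE : has_sup E by split=> //; exists (qf T x0 / nrm x0 ^+ 2); exact: ubE.
have mT : (sup E)%:O <=o T.
  apply: ople_scalP => // x; have [->|xn0] := eqVneq x 0.
    by rewrite nrm0 expr0n mulr0 /qf ip0r.
  by rewrite -ler_pdivlMr ?exprn_gt0 ?nrm_gt0 //; apply: ge_sup => //; exact: ubE.
(* Were [T - sup E] invertible, [pos_opinv_ge] would give a lower bound of [T] larger than the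
   supremum. *)
exists (sup E); split=> // /(pos_opinv_ge mT)[d d0 dT].
have : E (sup E + d) by rewrite /E /= /ople -scalD opprD addrA.
move=> /(sup_ubound hE.2); rewrite gerDl leNgt d0 //.
Qed.

(** * Polynomials in an operator *)

Definition peval (p : {poly C}) T : bop := \sum_(i < size p) p`_i *: T ^+ i.

Lemma peval_widen n (p : {poly C}) T :
  (size p <= n)%N -> peval p T = \sum_(i < n) p`_i *: T ^+ i.
Proof.
move=> pn; rewrite /peval (big_ord_widen n (fun i => p`_i *: T ^+ i) pn).
rewrite [RHS](bigID (fun i : 'I_n => (i < size p)%N)) /= [X in _ = _ + X]big1 ?addr0 //.
by move=> i; rewrite -leqNgt => pi; rewrite nth_default ?scale0r.
Qed.

Lemma pevalD (p q : {poly C}) T : peval (p + q) T = peval p T + peval q T.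
Proof.
set n := maxn (size p) (size q).
rewrite !(@peval_widen n) ?leq_maxl ?leq_maxr ?size_polyD // -big_split /=.
by apply: eq_bigr => i _; rewrite coefD scalerDl.
Qed.

Lemma pevalZ a (p : {poly C}) T : peval (a *: p) T = a *: peval p T.
Proof.
rewrite !(@peval_widen (size p)) ?size_scale_leq // scaler_sumr.
by apply: eq_bigr => i _; rewrite coefZ scalerA.
Qed.

Lemma pevalC a T : peval a%:P T = a *: (1 : bop).
Proof.
rewrite (@peval_widen 1) ?size_polyC ?leq_b1 // big_ord_recl big_ord0 addr0.
by rewrite coefC eqxx expr0.
Qed.

Lemma pevalMX (p : {poly C}) T : peval (p * 'X) T = peval p T * T.
Proof.
rewrite (@peval_widen (size p).+1); last first.
  by rewrite (leq_trans (size_polyMleq _ _)) // size_polyX addn2.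
rewrite big_ord_recl coefMX eqxx scale0r add0r /peval mulr_suml.
by apply: eq_bigr => i _; rewrite coefMX /= -bop_scaleAl exprSr.
Qed.

Lemma pevalM (p q : {poly C}) T : peval (p * q) T = peval p T * peval q T.
Proof.
elim/poly_ind: q => [|q c IHq].
  by rewrite mulr0 -[0]/(0%:P) pevalC scale0r mulr0.
rewrite mulrDr mulrA !pevalD !pevalMX IHq mulrDr -mulrA pevalC; congr (_ + _).
by rewrite mulrC mul_polyC pevalZ -bop_scaleAr mulr1.
Qed.

Lemma pevalX T : peval 'X T = T.
Proof. by rewrite -[X in peval X]mul1r pevalMX -[1]/(1%:P) pevalC scale1r mul1r. Qed.

Lemma peval_prod (rs : seq C) T : peval (\prod_(z <- rs) ('X - z%:P)) T =
  \prod_(z <- rs) (T - z *: (1 : bop)).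
Proof.
elim: rs => [|z rs IH]; first by rewrite !big_nil -[1]/(1%:P) pevalC scale1r.
by rewrite !big_cons pevalM IH -polyCN pevalD pevalX pevalC scaleNr.
Qed.

(** Real polynomials go through their complex images, which split into linear factors in
    [pos_pe]. *)
Definition pe (p : {poly R}) T := peval (map_poly (real_complex R) p) T.

Lemma peE (p : {poly R}) T : pe p T = \sum_(i < size p) (p`_i)%:C *: T ^+ i.
Proof.
rewrite /pe /peval size_map_poly; apply: eq_bigr => i _.
by rewrite coef_map.
Qed.

Lemma peD p q T : pe (p + q) T = pe p T + pe q T.
Proof. by rewrite /pe rmorphD pevalD. Qed.
Lemma peM p q T : pe (p * q) T = pe p T * pe q T.
Proof. by rewrite /pe rmorphM pevalM. Qed.
Lemma peC a T : pe a%:P T = a%:O.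
Proof. by rewrite /pe map_polyC pevalC. Qed.
Lemma peZ a p T : pe (a *: p) T = a%:C *: pe p T.
Proof. by rewrite -mul_polyC peM peC scalM. Qed.
Lemma peN p T : pe (- p) T = - pe p T.
Proof. by rewrite -scaleN1r peZ rmorphN1 scaleN1r. Qed.
Lemma peB p q T : pe (p - q) T = pe p T - pe q T.
Proof. by rewrite peD peN. Qed.
Lemma peX T : pe 'X T = T.
Proof. by rewrite /pe map_polyX pevalX. Qed.

Lemma pe_sa (p : {poly R}) T : sa T -> sa (pe p T).
Proof.
move=> sT; rewrite peE; elim/big_ind: _ => [|S U|i _]; first exact: sa0.
  exact: saD.
exact/saZ/saX.
Qed.

(** With [z = a + i b] and [w] its conjugate, [(T - z)(T - w) = (T - a)^2 + b^2] is at least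
    [b^2 > 0], hence invertible. *)
Lemma inv_nonreal T (a b : R) : sa T -> b != 0 -> opinv (T - (a +i* b) *: (1 : bop)).
Proof.
move=> sT b0; pose z := a +i* b; pose w := a +i* (- b).
pose p := ('X - a%:P) ^+ 2 + (b ^+ 2)%:P.
have pE : map_poly (real_complex R) p = ('X - z%:P) * ('X - w%:P).
  have -> : z%:P = (a%:C)%:P + (0 +i* b)%:P.
    by rewrite -polyCD; congr polyC; rewrite /z; simpc.
  have -> : w%:P = (a%:C)%:P - (0 +i* b)%:P.
    by rewrite -polyCN -polyCD; congr polyC; rewrite /w; simpc.
  have Y2 : (0 +i* b)%:P * (0 +i* b)%:P = - ((b ^+ 2)%:C)%:P :> {poly C}.
    by rewrite -polyCM -polyCN; congr polyC; rewrite expr2; simpc.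
  rewrite /p rmorphD rmorphXn rmorphB /= map_polyX !map_polyC /= -[X in _ + X]opprK -Y2.
  ring.
have xE u : peval ('X - u%:P) T = T - u *: (1 : bop).
  by rewrite -polyCN pevalD pevalX pevalC scaleNr.
have : opinv (pe p T).
  apply: (@inv_ge (b ^+ 2)); first by rewrite exprn_even_gt0.
  have s1 : sa (T - a%:O) by apply: saB => //; exact: sa_scal.
  rewrite /ople peD peC addrK expr2 peM peB peX peC.
  rewrite -[X in X * _]mulr1; apply: (pos_adj s1).
  by split=> [|x]; [exact: sa1 | rewrite qf1 sqr_ge0].
rewrite /pe pE pevalM !xE; apply: inv_factor.
by rewrite -!xE -!pevalM mulrC.
Qed.

(* If [m] is the bottom of the spectrum of [p(T)], then factoring [p - m] over
   the complex numbers yields a spectral value [l] of [T] with [p(l) = m]. *)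
Lemma pos_pe (p : {poly R}) T : sa T ->
  (forall l : R, ~ opinv (T - l%:O) -> 0 <= p.[l]) -> pos (pe p T).
Proof.
move=> sT pT; have sp := pe_sa p sT.
have [H0|H0] := pselect (exists x : H, x != 0); last first.
  split=> // x; have [->|x0] := eqVneq x 0; last by case: H0; exists x.
  by rewrite /qf ip0r.
have [m [mp Nmp]] := spectrum_bottom sp H0.
suff m0 : 0 <= m by exact: ople_pos (scal_pos _ m0) mp.
(* A constant [p] has no root to offer; the sign of [m] is then read at any spectral value of [T],
   and [spectrum_bottom] supplies one. *)
have [|pm0] := eqVneq (p - m%:P) 0.
  move=> /eqP; rewrite subr_eq0 => /eqP pm.
  by have [l [_ /pT]] := spectrum_bottom sT H0; rewrite pm hornerC.
pose q := map_poly (real_complex R) (p - m%:P).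
have q0 : q != 0 by rewrite map_poly_eq0.
have [rs qE] := closed_field_poly_normal q.
have [[z zrs zN]|zI] := pselect (exists2 z, z \in rs & ~ opinv (T - z *: (1 : bop))); last first.
  case: Nmp; rewrite -(peC m T) -peB /pe -/q qE pevalZ peval_prod.
  apply: invZ; first by rewrite lead_coef_eq0.
  elim: rs zI {qE} => [|z rs IH] zI; first by rewrite big_nil; exact: inv1.
  rewrite big_cons; apply: invM; last first.
    by apply: IH => -[w wrs wN]; apply: zI; exists w => //; rewrite inE wrs orbT.
  by apply: contrapT => zN; apply: zI; exists z => //; rewrite inE eqxx.
have rz : root q z by rewrite qE rootZ ?lead_coef_eq0 // root_prod_XsubC.
case: z zrs zN rz => a b _; have [->|b0] := eqVneq b 0; last first.
  by case; exact: inv_nonreal.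
move=> /pT pa /rootP; rewrite -[_ +i* _]/(a%:C) horner_map /= => /eqP.
by rewrite (inj_eq (@complexI R)) !hornerE subr_eq0 => /eqP <-.
Qed.

End SpectralPositivity.

(** * Functional calculus on an interval *)

Section FunctionalCalculus.
Import numFieldNormedType.Exports.
Local Open Scope classical_set_scope.
Local Open Scope ring_scope.
Local Open Scope complex_scope.
Variables (R : realType) (H : hilbertType R).
Local Notation C := R[i].
Local Notation bop := (bop H).
Implicit Types (S T U Z : bop) (f g : R -> R) (p q : {poly R}).

Definition sandwiched (m M : R) T := m%:O <=o T /\ T <=o M%:O.

Lemma sandwiched_sa m M T : sandwiched m M T -> sa T.
Proof. by move=> [/ople_scal_sa]. Qed.

Lemma sandwiched_spectrum m M T l :
  sandwiched m M T -> ~ opinv (T - l%:O) -> l \in `[m, M].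
Proof.
move=> [mT TM] Ni; rewrite in_itv /=; apply/andP; split.
- rewrite leNgt; apply/negP => lm; apply: Ni.
  apply: (@inv_ge _ _ (m - l)); first by rewrite subr_gt0.
  by rewrite /ople /scal rmorphB scalerBl opprB addrA subrK.
- rewrite leNgt; apply/negP => lM; apply: Ni.
  suff : opinv (l%:O - T).
    by move=> /(@invZ _ _ (-1)); rewrite scaleN1r opprB; apply; rewrite oppr_eq0 oner_eq0.
  apply: (@inv_ge _ _ (l - M)); first by rewrite subr_gt0.
  by rewrite /ople /scal rmorphB scalerBl opprB addrC subrKA.
Qed.

Lemma pe_bnd p T c : sa T -> 0 < c ->
  (forall l, ~ opinv (T - l%:O) -> `|p.[l]| <= c) -> bnd (pe p T) c.
Proof.
move=> sT c0 pc; apply: ople_bnd => //.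
- rewrite /ople /scal rmorphN scaleNr opprK -/(scal H c) -(peC c T) -peD.
  by apply: pos_pe => // l /pc; rewrite !hornerE ler_norml => /andP[]; lra.
- rewrite /ople -(peC c T) -peB.
  by apply: pos_pe => // l /pc; rewrite !hornerE ler_norml => /andP[]; lra.
Qed.

Lemma pe_bnd_sandwiched p m M T c : sandwiched m M T -> 0 < c ->
  {in `[m, M], forall x, `|p.[x]| <= c} -> bnd (pe p T) c.
Proof.
move=> wT c0 pc; apply: pe_bnd => //; first exact: sandwiched_sa wT.
by move=> l /(sandwiched_spectrum wT)/pc.
Qed.

Lemma spectrumP T (l : R) : spectrum T l%:C <-> ~ opinv (T - l%:O).
Proof.
have TE : (fun x => T x - l%:C *: x) = T - l%:O.
  by apply/funext => x; rewrite bopBE.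
rewrite /spectrum /= TE; split; apply: contra_not => -[].
- move=> S [TS ST]; exists S; split; first exact: bopP.
  + by move=> x; rewrite -bopME ST.
  + by move=> x; rewrite -bopME TS.
- move=> S [bS ST TS]; exists (Bop bS).
  by split; apply: bopE => x; [exact: TS | exact: ST].
Qed.

Lemma poly_operatorE p T : poly_operator p T = pe p T.
Proof.
apply/funext => x; rewrite peE /poly_operator.
rewrite (big_morph (fun T : bop => T x) (fun S T : bop => bopDE S T x) (bop0E x)).
by apply: eq_bigr => i _; rewrite bopZE bopX_iter.
Qed.

(* [S = f(T)], tested by uniform approximation of [f] on all of [[m, M]]. *)
Definition fcal m M f T S := forall e, 0 < e -> exists p,
  {in `[m, M], forall x, `|p.[x] - f x| <= e} /\ bnd (pe p T - S) e.

(** [S] witnesses that the calculus is defined. For uniqueness, two polynomials within [e] of [f] on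
    the spectrum differ there by [2 e], hence so do their values at [T]. The competitor [S'] is a
    bare function, so it is compared with [S] vector by vector. *)
Lemma fcal_calculus m M f T S : sandwiched m M T -> fcal m M f T S ->
  functional_calculus f T = S.
Proof.
move=> wT fS; have sT := sandwiched_sa wT.
have fcS : is_functional_calculus f T S.
  move=> e /fS[p [pf pS]]; exists p; split.
    by move=> l /spectrumP/(sandwiched_spectrum wT)/pf.
  by move=> x; rewrite poly_operatorE -bopBE !nrmE -rmorphM lecR.
rewrite /functional_calculus; case: xgetP => [S' _ /= fcS'|/(_ S)]; last by [].
apply/funext => x; apply/eqP; rewrite -subr_eq0; apply/eqP/nrm0_eq0/eqP.
rewrite eq_le nrm_ge0 andbT; apply/ler_addgt0Pr => d d0; rewrite add0r.
have x0 := nrm_ge0 x.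
have [e e0 ed] : exists2 e : R, 0 < e & 4 * e * nrm x <= d.
  exists (d / (4 * (nrm x + 1))); first by rewrite divr_gt0 // mulr_gt0 // ltr_wpDl.
  have -> : 4 * (d / (4 * (nrm x + 1))) * nrm x = d * (nrm x / (nrm x + 1)).
    by field; rewrite gt_eqF // ltr_wpDl.
  by rewrite ler_piMr ?(ltW d0) // ler_pdivrMr ?ltr_wpDl // mul1r lerDl.
have [p [pf pS]] := fcS e e0; have [q [qf qS]] := fcS' e e0.
have b : bnd (pe (p - q) T) (2 * e).
  apply: pe_bnd => //; first by rewrite mulr_gt0.
  move=> l /spectrumP ls; have := pf l ls; have := qf l ls.
  by rewrite !hornerE !ler_norml => /andP[? ?] /andP[? ?]; apply/andP; split; lra.
have h1 := b x; have := pS x; have := qS x.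
rewrite !poly_operatorE !nrmE -!rmorphM !lecR => h2 h3.
have -> : S' x - S x = (pe p T x - S x) - (pe q T x - S' x) - pe (p - q) T x.
  by rewrite peB bopBE !opprB -addrA subrKA addrC subrKA.
apply: le_trans ed; apply: (le_trans (ler_nrmD _ _)); rewrite nrmN.
apply: (le_trans (lerD (ler_nrmD _ _) h1)); rewrite nrmN; lra.
Qed.

Definition approximable m M f :=
  forall e, 0 < e -> exists p, {in `[m, M], forall x, `|p.[x] - f x| <= e}.

Lemma fcal_exists m M f T : sandwiched m M T -> approximable m M f ->
  exists S, fcal m M f T S.
Proof.
move=> wT fa; pose d n : R := 4^-1 * n.+1%:R^-1.
have d0 n : 0 < d n by rewrite mulr_gt0 ?invr_gt0.
have /choice[p_ p_f] n : exists p, {in `[m, M], forall x, `|p.[x] - f x| <= d n} by exact: fa.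
have d_small e : 0 < e -> exists N, forall n, (N <= n)%N -> d n <= e / 4.
  move=> e0; have [N hN] : exists N : nat, e^-1 < N%:R.
    exists (Num.truncn e^-1).+1; have /truncn_itv/andP[] // : 0 <= e^-1 by rewrite invr_ge0 ltW.
  exists N => n Nn; rewrite /d mulrC ler_pM2r ?invr_gt0 // -[e]invrK lef_pV2 ?posrE ?invr_gt0 //.
  by rewrite ltW // (lt_le_trans hN) // ler_nat leqW.
have pij e i j : d i <= e / 4 -> d j <= e / 4 -> 0 < e ->
    bnd (pe (p_ i) T - pe (p_ j) T) e.
  move=> di dj e0; rewrite -peB; apply: (pe_bnd_sandwiched wT) => // x xmM.
  have := p_f i x xmM; have := p_f j x xmM.
  by rewrite !hornerE !ler_norml => /andP[? ?] /andP[? ?]; apply/andP; split; lra.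
have [S hS] : exists S, forall e, 0 < e ->
    exists N, forall i, (N <= i)%N -> bnd (pe (p_ i) T - S) e.
  apply: bop_complete => e e0; have [N hN] := d_small e e0.
  by exists N => i j Ni Nj; apply: pij => //; exact: hN.
exists S => e e0; have [N hN] := d_small e e0; have [N' hN'] := hS e e0.
exists (p_ (maxn N N')); split; last exact/hN'/leq_maxr.
move=> x /p_f/le_trans; apply; apply: (le_trans (hN _ (leq_maxl _ _))); lra.
Qed.

(** Any polynomial close to [f] on the interval will do, not only the one chosen for [T]; so one
    polynomial can serve two operators in [fcal_intertwine]. *)
Lemma fcal_bnd m M f T S p e : sandwiched m M T -> fcal m M f T S -> 0 < e ->
  {in `[m, M], forall x, `|p.[x] - f x| <= e} -> bnd (pe p T - S) (3 * e).
Proof.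
move=> wT fS e0 pf; have [q [qf qS]] := fS e e0.
rewrite -(subrKA (pe q T)) -peB; have -> : 3 * e = 2 * e + e by lra.
apply: bndD => //; apply: (pe_bnd_sandwiched wT); first lra.
move=> x xmM; have := pf x xmM; have := qf x xmM.
by rewrite !hornerE !ler_norml => /andP[? ?] /andP[? ?]; apply/andP; split; lra.
Qed.

Lemma ipBl (x y z : H) : ip (x - y) z = ip x z - ip y z.
Proof. by rewrite -[- y]scaleN1r ipDl ipZl mulN1r. Qed.

(** Expansion of [|u - e v|^2 >= 0], a Cauchy-Schwarz inequality weighted for vectors [u] with
    [|u| <= e |v|]. *)
Lemma Re_ip_le e (u v : H) :
  2 * e * complex.Re (ip u v) <= nrm u ^+ 2 + e ^+ 2 * nrm v ^+ 2.
Proof.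
have : 0 <= complex.Re (ip (u - e%:C *: v) (u - e%:C *: v)).
  by rewrite ip_nrm /= sqr_ge0.
rewrite -scaleNr -rmorphN !(ipDl, ipDr, ipZl, ipZr) [ip v u]ipC !conjc_real !ip_nrm.
by case: (ip u v) => x y /=; lra.
Qed.

(** It is enough to bound the real part of the defect [z x y] above by 0: replacing [x] by [- x]
    makes that real part vanish, and replacing [x] by [i x] does the same for the imaginary part. *)
Lemma sa_limit S : (forall e, 0 < e -> exists2 T, sa T & bnd (T - S) e) -> sa S.
Proof.
move=> hS; pose z x y := ip (S x) y - ip x (S y).
have Rz x y : complex.Re (z x y) <= 0.
  apply/ler_addgt0Pr => d d0; rewrite add0r.
  have n0 : 0 <= nrm x ^+ 2 + nrm y ^+ 2 by rewrite addr_ge0 ?sqr_ge0.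
  have [e e0 ed] : exists2 e : R, 0 < e & e * (nrm x ^+ 2 + nrm y ^+ 2) <= d.
    exists (d / (nrm x ^+ 2 + nrm y ^+ 2 + 1)); first by rewrite divr_gt0 // ltr_wpDl.
    by rewrite -mulrA ler_piMr ?(ltW d0) // mulrC ler_pdivrMr ?ltr_wpDl // mul1r lerDl.
  apply: le_trans ed; have [T sT TS] := hS e e0.
  have sq u : nrm ((T - S) u) ^+ 2 <= e ^+ 2 * nrm u ^+ 2.
    by rewrite -exprMn ler_sqr ?nnegrE ?mulr_ge0 ?nrm_ge0 ?(ltW e0).
  have zE : complex.Re (z x y) =
      complex.Re (ip (- (T - S) x) y) + complex.Re (ip ((T - S) y) x).
    rewrite /z [ip x (S y)]ipC !bopBE opprB !ipBl sT [ip x (T y)]ipC.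
    case: (ip (T y) x) (ip (S x) y) (ip (S y) x) => [u1 u2] [v1 v2] [w1 w2] /=.
    by lra.
  have := Re_ip_le e (- (T - S) x) y; have := Re_ip_le e ((T - S) y) x.
  have := sq x; have := sq y; rewrite nrmN => h1 h2 h3 h4.
  rewrite -(ler_pM2l (_ : 0 < 2 * e)) ?mulr_gt0 // zE; lra.
have zN x y : z (- x) y = - z x y.
  by rewrite /z bopN -[- x]sub0r -[- S x]sub0r !ipBl !ip0l !sub0r opprD opprK.
have z0 x y : complex.Re (z x y) = 0.
  have := Rz x y; have := Rz (- x) y; rewrite zN; case: (z x y) => u v /=; lra.
move=> x y; apply/eqP; rewrite -subr_eq0 -/(z x y); apply/eqP.
have := z0 ('i%C *: x) y; have := z0 x y.
have -> : z ('i%C *: x) y = 'i%C * z x y by rewrite /z bopZ !ipZl mulrBr.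
by case: (z x y) => u v /= -> h; congr Complex; lra.
Qed.

Lemma fcal_sa m M f T S : sandwiched m M T -> fcal m M f T S -> sa S.
Proof.
move=> wT fS; apply: sa_limit => e /fS[p [_ pS]].
by exists (pe p T) => //; exact: pe_sa (sandwiched_sa wT).
Qed.

Lemma pos_limit S : sa S -> (forall e, 0 < e -> (- e)%:O <=o S) -> pos S.
Proof.
move=> sS h; split=> // x; apply/ler_addgt0Pr => e e0.
have x0 := nrm_ge0 x; have x1 : 0 < nrm x ^+ 2 + 1 by rewrite ltr_wpDl // sqr_ge0.
have := ople_qf x (h (e / (nrm x ^+ 2 + 1)) (divr_gt0 e0 x1)); rewrite qf_scal.
have : e / (nrm x ^+ 2 + 1) * nrm x ^+ 2 <= e.
  by rewrite -mulrA ler_piMr ?(ltW e0) // mulrC ler_pdivrMr // mul1r lerDl.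
lra.
Qed.

(** The slack [c] serves the limits in the exponent and towards the logarithm; with [c = 0] it is
    monotonicity. *)
Lemma fcal_le m M f g T S U c : sandwiched m M T ->
  fcal m M f T S -> fcal m M g T U ->
  {in `[m, M], forall x, f x <= g x + c} -> S <=o U + c%:O.
Proof.
move=> wT fS gU fg; have sT := sandwiched_sa wT.
have sS := fcal_sa wT fS; have sU := fcal_sa wT gU.
have sc a : sa (a%:O : bop) by exact: sa_scal.
apply: pos_limit => [|e e0]; first by apply: saB => //; exact: saD.
(* Two errors [e / 4] on the interval are covered by the [e / 2] added to the polynomial; two more
   in operator norm use up the rest of [e]. *)
have e4 : 0 < e / 4 by rewrite divr_gt0.
have [p [pf pS]] := fS _ e4; have [q [qg qU]] := gU _ e4.
have sp := pe_sa p sT; have sq := pe_sa q sT.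
have [h1 _] := bnd_ople e4 (saB sp sS) pS.
have [_ h2] := bnd_ople e4 (saB sq sU) qU.
have h3 : pos (pe (q + c%:P - p + (e / 2)%:P) T).
  apply: pos_pe => // l /(sandwiched_spectrum wT) lmM.
  have := fg l lmM; have := pf l lmM; have := qg l lmM.
  by rewrite !hornerE !ler_norml => /andP[? ?] /andP[? ?]; lra.
split; first by apply: saB => //; apply: saB => //; exact: saD.
move=> x; have := h3.2 x; have := ople_qf x h1; have := ople_qf x h2.
rewrite !(peD, peN, peC) !(qfD, qfN, qf_scal).
have := sqr_ge0 (nrm x); lra.
Qed.

Lemma fcal_poly m M T p : fcal m M (fun x => p.[x]) T (pe p T).
Proof.
move=> e e0; exists p; split=> [x _|]; first by rewrite subrr normr0 ltW.
by rewrite subrr; apply: bnd_le (@bnd0 _ _); exact: ltW.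
Qed.

Lemma fcal_ext m M f g T S : {in `[m, M], f =1 g} -> fcal m M f T S -> fcal m M g T S.
Proof.
move=> fg fS e /fS[p [pf pS]]; exists p; split=> // x xmM.
by rewrite -fg // pf.
Qed.

Lemma fcal_uniq m M f T S U : sandwiched m M T ->
  fcal m M f T S -> fcal m M f T U -> S = U.
Proof.
move=> wT fS fU; apply: bopE => x.
by rewrite -(fcal_calculus wT fS) (fcal_calculus wT fU).
Qed.

Lemma fcal_approx_eq m M f T S :
  (forall e, 0 < e -> exists g U, [/\ {in `[m, M], forall x, `|g x - f x| <= e},
     fcal m M g T U & bnd (U - S) e]) -> fcal m M f T S.
Proof.
move=> h e e0; have e2 : 0 < e / 2 by rewrite divr_gt0.
have [g [U [gf gU US]]] := h _ e2; have [p [pg pU]] := gU _ e2.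
exists p; split=> [x xmM|].
  have := pg x xmM; have := gf x xmM.
  by rewrite !ler_norml => /andP[? ?] /andP[? ?]; apply/andP; split; lra.
by rewrite -(subrKA U) [e]splitr; exact: bndD.
Qed.

Lemma fcal_bounded m M f T S : fcal m M f T S ->
  exists2 K : R, 0 < K & {in `[m, M], forall x, `|f x| <= K}.
Proof.
move=> /(_ 1 ltr01)[p [pf _]]; pose r := `|m| + `|M|.
exists (poly_bound p 0 r + 1); first by rewrite ltr_wpDl ?poly_bound_ge0.
move=> x xmM; have := pf x xmM; rewrite distrC => h.
rewrite -[f x](subrK p.[x]) addrC; apply: (le_trans (ler_normD _ _)).
apply: lerD => //; apply: poly_boundP; rewrite subr0.
move: xmM; rewrite in_itv /= => /andP[mx xM]; rewrite /r ler_norml.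
have := ler_norm M; have := ler_norm (- m); rewrite normrN => ? ?.
have := normr_ge0 m; have := normr_ge0 M => ? ?; apply/andP; split; lra.
Qed.

Lemma fcalD m M f g T S U : fcal m M f T S -> fcal m M g T U ->
  fcal m M (fun x => f x + g x) T (S + U).
Proof.
move=> fS gU e e0; have e2 : 0 < e / 2 by rewrite divr_gt0.
have [p [pf pS]] := fS _ e2; have [q [qg qU]] := gU _ e2.
exists (p + q); split=> [x xmM|].
  have := pf x xmM; have := qg x xmM.
  by rewrite !hornerE !ler_norml => /andP[? ?] /andP[? ?]; apply/andP; split; lra.
by rewrite peD opprD addrACA [e]splitr; exact: bndD.
Qed.

Lemma fcalM m M f g T S U : sandwiched m M T -> fcal m M f T S -> fcal m M g T U ->
  fcal m M (fun x => f x * g x) T (S * U).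
Proof.
move=> wT fS gU e e0.
have [K K0 fK] := fcal_bounded fS; have [L L0 gL] := fcal_bounded gU.
have [k k0 Sk] := bnd_exists S; have [l l0 Ul] := bnd_exists U.
pose D := (K + L + k + l + 1); have D0 : 0 < D by rewrite /D; lra.
pose d := Num.min 1 (e / D).
have d0 : 0 < d by rewrite lt_min ltr01 divr_gt0.
have d1 : d <= 1 by rewrite ge_min lexx.
have dD : d * D <= e by rewrite -ler_pdivlMr // ge_min lexx orbT.
have [p [pf pS]] := fS _ d0; have [q [qg qU]] := gU _ d0.
(* One estimate for both error terms: at the values of [f] and [g], then at the norm bounds of [S]
   and [U]. As [d <= 1], the product of the two errors is at most [d]. *)
have close (b b' A B : R) : 0 <= A -> 0 <= B -> b <= d -> b' <= d -> A + B + 1 <= D ->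
   0 <= b -> 0 <= b' -> b * b' + b * A + B * b' <= e.
  move=> A0 B0 bd bd' AB b0 b0'; apply: le_trans dD.
  have h1 : b * b' <= d * 1 by rewrite ler_pM // (le_trans bd').
  have h2 : b * A <= d * A by rewrite ler_wpM2r.
  have h3 : B * b' <= d * B by rewrite mulrC ler_wpM2r.
  have : d * (A + B + 1) <= d * D by rewrite ler_pM2l.
  lra.
exists (p * q); split=> [x xmM|].
  have := pf x xmM; have := qg x xmM; have := fK x xmM; have := gL x xmM => h1 h2 h3 h4.
  have -> : (p * q).[x] - f x * g x =
    (p.[x] - f x) * (q.[x] - g x) + (p.[x] - f x) * g x + f x * (q.[x] - g x).
    by rewrite hornerM; ring.
  apply: (le_trans (ler_normD _ _)); rewrite normrM.
  apply: (le_trans (lerD (ler_normD _ _) (lexx _))); rewrite !normrM.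
  by apply: close => //; rewrite /D; lra.
have -> : pe (p * q) T - S * U =
    (pe p T - S) * (pe q T - U) + (pe p T - S) * U + S * (pe q T - U).
  by rewrite -mulrDr subrK mulrBl mulrBr peM addrA subrK.
apply: (@bnd_le _ _ _ (d * d + d * l + k * d)).
  by apply: close; rewrite /D ?(ltW k0) ?(ltW l0) ?(ltW d0) //; lra.
by apply: bndD; [apply: bndD|]; apply: bndM => //; exact: ltW.
Qed.

Lemma fcal_comp_poly m M f T S p : sandwiched m M T -> fcal m M f T S ->
  fcal m M (fun x => p.[f x]) T (pe p S).
Proof.
move=> wT fS; elim/poly_ind: p => [|p c IHp].
  apply: (@fcal_ext _ _ (fun x => (0 : {poly R}).[x])).
    by move=> x _; rewrite !hornerE.
  by have := @fcal_poly m M T 0; rewrite -[0]/(0%:P) !peC.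
apply: (@fcal_ext _ _ (fun x => p.[f x] * f x + c%:P.[x])).
  by move=> x _; rewrite !hornerE.
rewrite peD peM peX peC; apply: fcalD; first exact: fcalM.
by have := @fcal_poly m M T c%:P; rewrite peC.
Qed.

Lemma fcal_comp m M m' M' f g T S U : sandwiched m M T -> fcal m M f T S ->
  {in `[m, M], forall x, f x \in `[m', M']} -> sandwiched m' M' S ->
  fcal m' M' g S U -> fcal m M (g \o f) T U.
Proof.
move=> wT fS fmM wS gU; apply: fcal_approx_eq => e /gU[p [pg pU]].
exists (fun x => p.[f x]), (pe p S); split=> // [x xmM|].
  exact/pg/fmM.
exact: fcal_comp_poly.
Qed.

Lemma fcal_sandwiched m M m' M' f T S : sandwiched m M T -> fcal m M f T S ->
  {in `[m, M], forall x, f x \in `[m', M']} -> sandwiched m' M' S.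
Proof.
move=> wT fS fmM; have c a := @fcal_poly m M T a%:P; split.
- have := @fcal_le _ _ _ _ _ _ _ 0 wT (c m') fS.
  rewrite peC /scal scale0r addr0; apply => x /fmM; rewrite in_itv /= hornerC addr0.
  by case/andP.
- have := @fcal_le _ _ _ _ _ _ _ 0 wT fS (c M').
  rewrite peC /scal scale0r addr0; apply => x /fmM; rewrite in_itv /= hornerC addr0.
  by case/andP.
Qed.

Lemma pe_intertwine p T U Z : Z * T = U * Z -> Z * pe p T = pe p U * Z.
Proof.
move=> ZT; elim/poly_ind: p => [|p c IHp].
  by rewrite -[0]/(0%:P) !peC /scal scale0r mulr0 mul0r.
rewrite !peD !peM !peX !peC mulrDr mulrDl mulrA IHp -!mulrA ZT.
by rewrite mulScal scalM.
Qed.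

Lemma fcal_intertwine m M f T T' S S' Z : sandwiched m M T -> sandwiched m M T' ->
  fcal m M f T S -> fcal m M f T' S' -> Z * T = T' * Z -> Z * S = S' * Z.
Proof.
move=> wT wT' fS fS' ZT; apply/eqP; rewrite -subr_eq0; apply/eqP/bnd_eq0 => e e0.
(* The polynomial is chosen for [T] at cost [d] and costs [3 d] at [T'], for a total of [4 d z],
   less than [e = 6 d z]. *)
have [z z0 Zz] := bnd_exists Z; pose d := e / (6 * z).
have d0 : 0 < d by rewrite divr_gt0 // mulr_gt0.
have [p [pf pS]] := fS d d0; have pS' := fcal_bnd wT' fS' d0 pf.
have -> : Z * S - S' * Z = (pe p T' - S') * Z - Z * (pe p T - S).
  by rewrite mulrBl mulrBr (pe_intertwine p ZT) opprB [RHS]addrC subrKA.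
apply: (@bnd_le _ _ _ (3 * d * z + z * d)).
  have -> : e = 6 * (d * z) by rewrite /d; field; rewrite gt_eqF.
  have : 0 < d * z by exact: mulr_gt0.
  lra.
by apply: bndB; apply: bndM => //; lra.
Qed.

End FunctionalCalculus.

(** * Powers: the Loewner-Heinz and Furuta inequalities *)

Section OperatorPowers.
Local Open Scope classical_set_scope.
Local Open Scope ring_scope.
Local Open Scope complex_scope.
Variables (R : realType) (H : hilbertType R).
Local Notation bop := (bop H).
Implicit Types (P Q S T U Z : bop) (f g : R -> R) (a b c m M : R).

Definition posinv T := pos T /\ opinv T.

Lemma posinv_sa T : posinv T -> sa T. Proof. by move=> [[]]. Qed.

Lemma posinv_ge c T : 0 < c -> c%:O <=o T -> posinv T.
Proof.
move=> c0 cT; split; last exact: inv_ge cT.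
exact: ople_pos (scal_pos _ (ltW c0)) cT.
Qed.

Lemma sandwichedW m M (m' M' : R) T :
  m' <= m -> M <= M' -> sandwiched m M T -> sandwiched m' M' T.
Proof.
move=> mm MM [mT TM]; split.
- exact: ople_trans (ople_scal _ mm) mT.
- exact: ople_trans TM (ople_scal _ MM).
Qed.

Lemma posinv_sandwiched T : posinv T -> exists m M, [/\ 0 < m, m < M & sandwiched m M T].
Proof.
move=> [pT iT]; have [m m0 mT] := pos_opinv_ge pT iT.
have [M M0 /(bnd_ople M0 pT.1)[_ TM]] := bnd_exists T.
exists m, (m + M); split=> //; first by rewrite ltrDl.
by split=> //; apply: (ople_trans TM); apply: ople_scal; rewrite lerDr ltW.
Qed.

Lemma posinv_sandwiched2 S T : posinv S -> posinv T ->
  exists m M, [/\ 0 < m, m < M, sandwiched m M S & sandwiched m M T].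
Proof.
move=> /posinv_sandwiched[m [M [m0 mM wS]]] /posinv_sandwiched[m' [M' [m0' mM' wT]]].
exists (Num.min m m'), (Num.max M M'); split.
- by rewrite lt_min m0.
- by rewrite lt_max gt_min mM.
- by apply: sandwichedW wS; rewrite ?ge_min ?le_max lexx.
- by apply: sandwichedW wT; rewrite ?ge_min ?le_max lexx orbT.
Qed.

Definition approx_pos f := forall m M, 0 < m -> m < M -> approximable m M f.

Lemma approx_pos_powR a : approx_pos (fun l : R => l `^ a).
Proof.
move=> m M m0 mM e e0; have [L hL] := @powR_lipschitz _ m M a m0.
exact: weierstrass mM e0 hL.
Qed.

Lemma approx_pos_ln : approx_pos (@ln R).
Proof.
move=> m M m0 mM e e0; apply: (@weierstrass _ _ m M m^-1) => // x y.
rewrite !in_itv /= => /andP[mx _] /andP[my _].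
by apply: ln_lipschitz; rewrite // in_itv /= andbT.
Qed.

(* [f(T)] as an element of [bop], with the junk value 0 when there is none. *)
Definition ofun f T : bop :=
  xget 0 [set S | forall m M, 0 < m -> m < M -> sandwiched m M T -> fcal m M f T S].

(** The operator built on one interval fits every other: both candidates equal
    [functional_calculus f T], which does not mention the interval. *)
Lemma ofunP f T m M : approx_pos f -> posinv T -> 0 < m -> m < M ->
  sandwiched m M T -> fcal m M f T (ofun f T).
Proof.
move=> fa /posinv_sandwiched[m0 [M0 [m00 mM0 w0]]].
have [S hS] := fcal_exists w0 (fa _ _ m00 mM0).
rewrite /ofun; case: xgetP => [S' _ hS' m1 mM w|/(_ S) nS]; first exact: hS'.
case: nS => m' M' m0' mM' w'; have [S' hS'] := fcal_exists w' (fa _ _ m0' mM').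
suff -> : S = S' by [].
by apply: bopE => x; rewrite -(fcal_calculus w0 hS) -(fcal_calculus w' hS').
Qed.

Lemma functional_calculusE f T : approx_pos f -> posinv T ->
  functional_calculus f T = ofun f T.
Proof.
move=> fa pT; have [m [M [m0 mM w]]] := posinv_sandwiched pT.
exact: fcal_calculus w (ofunP fa pT m0 mM w).
Qed.

Definition opow T a := ofun (fun l : R => l `^ a) T.
Definition olog T := ofun (@ln R) T.
Local Notation "T `^^ a" := (opow T a) (at level 29, left associativity).

Lemma operator_powE T a : posinv T -> operator_pow T a = T `^^ a.
Proof. exact/functional_calculusE/approx_pos_powR. Qed.

Lemma operator_logE T : posinv T -> operator_log T = olog T.
Proof. exact/functional_calculusE/approx_pos_ln. Qed.

Lemma opowP T a m M : posinv T -> 0 < m -> m < M -> sandwiched m M T ->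
  fcal m M (fun l : R => l `^ a) T (T `^^ a).
Proof. exact/ofunP/approx_pos_powR. Qed.

Opaque opow olog.

Lemma opow0 T : posinv T -> T `^^ 0 = 1.
Proof.
move=> pT; have [m [M [m0 mM w]]] := posinv_sandwiched pT.
apply: (fcal_uniq w (opowP _ pT m0 mM w)).
have := @fcal_poly _ _ m M T 1%:P; rewrite peC /scal scale1r.
by apply: fcal_ext => x _; rewrite hornerC powRr0.
Qed.

Lemma opow1 T : posinv T -> T `^^ 1 = T.
Proof.
move=> pT; have [m [M [m0 mM w]]] := posinv_sandwiched pT.
apply: (fcal_uniq w (opowP _ pT m0 mM w)).
have := @fcal_poly _ _ m M T 'X; rewrite peX.
apply: fcal_ext => x; rewrite in_itv /= => /andP[mx _].
by rewrite hornerX powRr1 // ltW // (lt_le_trans m0).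
Qed.

Lemma opowD T a b : posinv T -> T `^^ (a + b) = T `^^ a * T `^^ b.
Proof.
move=> pT; have [m [M [m0 mM w]]] := posinv_sandwiched pT.
apply: (fcal_uniq w (opowP _ pT m0 mM w)).
have := fcalM w (opowP a pT m0 mM w) (opowP b pT m0 mM w).
apply: fcal_ext => x; rewrite in_itv /= => /andP[mx _].
have x0 := lt_le_trans m0 mx; rewrite powRD //.
by rewrite (gt_eqF x0) implybT.
Qed.

Lemma opowDE T a b c : posinv T -> a + b = c -> T `^^ a * T `^^ b = T `^^ c.
Proof. by move=> pT <-; rewrite opowD. Qed.

Lemma opowNl T a : posinv T -> T `^^ (- a) * T `^^ a = 1.
Proof. by move=> pT; rewrite -opowD // addNr opow0. Qed.

Lemma opowNr T a : posinv T -> T `^^ a * T `^^ (- a) = 1.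
Proof. by move=> pT; rewrite -opowD // addrN opow0. Qed.

Lemma opow_itv m M a : 0 < m -> exists m' M' : R,
  [/\ 0 < m', m' < M' & {in `[m, M], forall x : R, x `^ a \in `[m', M']}].
Proof.
move=> m0; have [K K0 lnK] := @ln_bounded _ m M m0.
(* The [+ 1] keeps the interval nondegenerate when [a = 0]. *)
exists (expR (- (`|a| * K + 1))), (expR (`|a| * K + 1)); split.
- exact: expR_gt0.
- have : 0 <= `|a| * K by rewrite mulr_ge0 // ltW.
  by rewrite ltr_expR; lra.
move=> x xmM; have : `|a * ln x| <= `|a| * K by rewrite normrM ler_wpM2l // lnK.
rewrite in_itv /= powRE; last by move: xmM; rewrite in_itv /= => /andP[/(lt_le_trans m0)].
by rewrite !ler_expR ler_norml => /andP[? ?]; apply/andP; split; lra.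
Qed.

Lemma opow_posinv T a : posinv T -> posinv (T `^^ a).
Proof.
move=> pT; have [m [M [m0 mM w]]] := posinv_sandwiched pT.
have [m' [M' [m0' _ fmM]]] := opow_itv M a m0.
exact: posinv_ge m0' (fcal_sandwiched w (opowP a pT m0 mM w) fmM).1.
Qed.

Lemma opow_sa T a : posinv T -> sa (T `^^ a).
Proof. by move=> /(opow_posinv a)/posinv_sa. Qed.

Lemma opow_opinv T a : posinv T -> opinv (T `^^ a).
Proof. by move=> /(opow_posinv a)[]. Qed.

Lemma opowM T a b : posinv T -> T `^^ a `^^ b = T `^^ (a * b).
Proof.
move=> pT; have [m [M [m0 mM w]]] := posinv_sandwiched pT.
have [m' [M' [m0' mM' fmM]]] := opow_itv M a m0.
have fa := opowP a pT m0 mM w; have w' := fcal_sandwiched w fa fmM.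
apply: (fcal_uniq w) (opowP _ pT m0 mM w).
have := fcal_comp w fa fmM w' (opowP b (opow_posinv a pT) m0' mM' w').
by apply: fcal_ext => x _ /=; rewrite powRrM.
Qed.

Lemma opowMn T n : posinv T -> T `^^ n%:R = T ^+ n.
Proof.
move=> pT; elim: n => [|n IHn]; first by rewrite opow0.
by rewrite -natr1 opowD // IHn opow1 // exprSr.
Qed.

Lemma opow_intertwine S T a Z : posinv S -> posinv T -> Z * S = T * Z ->
  Z * S `^^ a = T `^^ a * Z.
Proof.
move=> pS pT; have [m [M [m0 mM wS wT]]] := posinv_sandwiched2 pS pT.
exact: fcal_intertwine wS wT (opowP a pS m0 mM wS) (opowP a pT m0 mM wT).
Qed.

Lemma posinv_adj S S' T : adjoint S S' -> opinv S -> opinv S' -> posinv T ->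
  posinv (S' * T * S).
Proof.
move=> aS iS iS' [pT iT]; split; first exact: pos_adj.
by apply: invM => //; exact: invM.
Qed.

Lemma posinv_conj S T : sa S -> opinv S -> posinv T -> posinv (S * T * S).
Proof. by move=> sS iS; exact: posinv_adj. Qed.

(** [Re_ip_le] at [S (S' x)] and [x] reads [2 |S' x|^2 <= |S (S' x)|^2 + |x|^2], and the first term
    on the right is at most [|S' x|^2]. *)
Lemma bnd_adjoint S S' : adjoint S S' -> bnd S 1 -> bnd S' 1.
Proof.
move=> aS bS x; have := Re_ip_le 1 (S (S' x)) x; rewrite aS ip_nrm /=.
have := bS (S' x); rewrite !mul1r => h1 h2.
have h3 : nrm (S (S' x)) ^+ 2 <= nrm (S' x) ^+ 2 by rewrite ler_sqr ?nnegrE ?nrm_ge0.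
rewrite -(@ler_sqr R) ?nnegrE ?nrm_ge0 //; lra.
Qed.

Lemma bnd1P S S' : adjoint S S' -> bnd S 1 <-> S' * S <=o 1.
Proof.
move=> aS; have sSS : sa (S' * S).
  by have := sa_adjM (adjointC aS) (@sa1 _ H); rewrite mulr1.
split=> [bS|h x].
- split; first by apply: saB => //; exact: sa1.
  move=> x; rewrite qfB qf1 (qf_adj _ aS) subr_ge0 ler_sqr ?nnegrE ?nrm_ge0 //.
  by have := bS x; rewrite mul1r.
- have := ople_qf x h; rewrite qf1 (qf_adj _ aS) mul1r.
  by rewrite ler_sqr ?nnegrE ?nrm_ge0.
Qed.

(** * Comparison of powers through contractions, and the Loewner-Heinz inequality *)

Lemma opow_adj S T a b : posinv S -> posinv T ->
  adjoint (S `^^ a * T `^^ b) (T `^^ b * S `^^ a).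
Proof. by move=> pS pT; apply: adjointM; exact: opow_sa. Qed.

Lemma opow_half T a : posinv T -> T `^^ (a / 2) * T `^^ (a / 2) = T `^^ a.
Proof. by move=> pT; apply: opowDE => //; rewrite -splitr. Qed.

Lemma opow_le_bnd P Q a : posinv P -> posinv Q -> Q `^^ a <=o P `^^ a ->
  bnd (Q `^^ (a / 2) * P `^^ (- (a / 2))) 1.
Proof.
move=> pP pQ QP; apply/(bnd1P (opow_adj _ _ pQ pP)).
have := ople_adj (opow_sa (- (a / 2)) pP) QP.
rewrite -(opow_half a pP) -(opow_half a pQ) !mulrA (opowNl _ pP) mul1r.
by rewrite (opowNr _ pP).
Qed.

(** The hypothesis makes [Q^(a/2) P^(-a/2)] a contraction. So is its adjoint, which gives
    [Q^(a/2) P^(-a) Q^(a/2) <= 1]; conjugation by [Q^(-a/2)] concludes. *)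
Lemma opow_antitone P Q a : posinv P -> posinv Q -> Q `^^ a <=o P `^^ a ->
  P `^^ (- a) <=o Q `^^ (- a).
Proof.
move=> pP pQ /(opow_le_bnd pP pQ)/(bnd_adjoint (opow_adj _ _ pQ pP)).
move=> /(bnd1P (opow_adj _ _ pP pQ)) h.
have := ople_adj (opow_sa (- (a / 2)) pQ) h.
rewrite !mulrA (opowNl _ pQ) mul1r -!mulrA (opowNr _ pQ) !mulr1 !mul1r.
have e : - (a / 2) + - (a / 2) = - a by rewrite -opprD -splitr.
by rewrite (opowDE pP e) (opowDE pQ e).
Qed.

Lemma opinv_contraction (L : bop) l : 1 < l -> bnd L 1 -> opinv (L - l%:O).
Proof.
move=> l1 bL; have l0 : 0 < l by rewrite (lt_trans _ l1).
have : opinv (1 - (l^-1)%:O * L).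
  apply: (@inv_neumann _ _ _ l^-1); first by rewrite invr_ge0 ltW //= invf_lt1.
  move=> x; rewrite bopME scalE nrmZ.
  have -> : complex.Re `|(l^-1)%:C| = l^-1.
    by rewrite normc_def /= expr0n addr0 sqrtr_sqr gtr0_norm ?invr_gt0.
  by rewrite ler_pM2l ?invr_gt0 //; have := bL x; rewrite mul1r.
move=> /(@invZ _ _ (- l%:C)); rewrite oppr_eq0 (inj_eq (@complexI R)) gt_eqF // => /(_ isT).
rewrite scalerBr scalM scalerA mulNr -rmorphM divff ?gt_eqF // scaleN1r opprK.
by rewrite scaleNr addrC.
Qed.

(* [P^(-c/2) Q^c P^(-c/2)], with [c = (a + b) / 2], is similar to the product
   of contractions [(P^(-a/2) Q^(a/2)) (Q^(b/2) P^(-b/2))]. *)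
Lemma lh_midpoint P Q a b : posinv P -> posinv Q ->
  Q `^^ a <=o P `^^ a -> Q `^^ b <=o P `^^ b ->
  Q `^^ ((a + b) / 2) <=o P `^^ ((a + b) / 2).
Proof.
move=> pP pQ Qa Qb; set c := (a + b) / 2.
pose L := P `^^ (- (a / 2)) * Q `^^ c * P `^^ (- (b / 2)).
pose K := P `^^ (- (c / 2)) * Q `^^ c * P `^^ (- (c / 2)).
have bL : bnd L 1.
  have e : a / 2 + b / 2 = c by rewrite /c; field.
  have -> : L = (P `^^ (- (a / 2)) * Q `^^ (a / 2)) * (Q `^^ (b / 2) * P `^^ (- (b / 2))).
    by rewrite /L -(opowDE pQ e) !mulrA.
  have := bndM ler01 (bnd_adjoint (opow_adj _ _ pQ pP) (opow_le_bnd pP pQ Qa))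
    (opow_le_bnd pP pQ Qb).
  by rewrite mul1r.
have KL : K = P `^^ ((a - b) / 4) * L * P `^^ (- ((a - b) / 4)).
  have e1 : (a - b) / 4 + - (a / 2) = - (c / 2) by rewrite /c; field.
  have e2 : - (b / 2) + - ((a - b) / 4) = - (c / 2) by rewrite /c; field.
  by rewrite /K -{1}(opowDE pP e1) -(opowDE pP e2) /L !mulrA.
have sK : sa K by apply: sa_adjM; exact: opow_sa.
(* [L] need not be self-adjoint, so its norm bound does not pass to [K] directly. Similarity carries
   over the invertibility of [L - l] for [l > 1], and for the self-adjoint [K] this spectral bound
   is an order bound. *)
have K1 : pos (pe (1 - 'X) K).
  apply: pos_pe => // l Nl; rewrite !hornerE subr_ge0 leNgt; apply/negP => l1; apply: Nl.
  have -> : K - l%:O = P `^^ ((a - b) / 4) * (L - l%:O) * P `^^ (- ((a - b) / 4)).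
    by rewrite mulrBr mulrBl -KL mulScal -bop_scaleAl (opowNr _ pP).
  apply: invM; [apply: invM|]; [exact: opow_opinv | | exact: opow_opinv].
  exact: opinv_contraction.
rewrite peB -[1]/(1%:P) peC peX /scal scale1r in K1.
have := ople_adj (opow_sa (c / 2) pP) (K1 : K <=o 1).
rewrite mulr1 (opow_half c pP) /K !mulrA (opowNr _ pP) mul1r -mulrA (opowNl _ pP).
by rewrite mulr1.
Qed.

Lemma opleD2r S T U : S <=o T -> S + U <=o T + U.
Proof. by rewrite /ople opprD addrACA subrr addr0. Qed.

Lemma ople_limit S T : sa S -> sa T -> (forall e, 0 < e -> S <=o T + e%:O) -> S <=o T.
Proof.
move=> sS sT h; apply: pos_limit; first exact: saB.
move=> e e0; have := h e e0; rewrite /ople /scal rmorphN scaleNr opprK.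
by rewrite addrAC.
Qed.

(** A dyadic of level [k + 1] is the midpoint of the two of level [k] whose numerators are the
    halves of [j] rounded down and up. *)
Lemma lh_dyadic P Q k j : posinv P -> posinv Q -> Q <=o P -> (j <= 2 ^ k)%N ->
  Q `^^ (j%:R / (2 ^ k)%:R) <=o P `^^ (j%:R / (2 ^ k)%:R).
Proof.
move=> pP pQ QP; elim: k j => [|k IHk] j jk.
  rewrite expn0 divr1; case: j jk => [|[|//]] _; first by rewrite !opow0 //; exact: ople_refl.
  by rewrite !opow1.
have k0 : (2 ^ k)%:R != 0 :> R by rewrite pnatr_eq0 expn_eq0.
have jE := odd_double_half j; rewrite expnS in jk.
have -> : j%:R / (2 ^ k.+1)%:R =
    (j./2%:R / (2 ^ k)%:R + (j - j./2)%:R / (2 ^ k)%:R) / 2 :> R.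
  rewrite -mulrDl -natrD subnKC; last by lia.
  by rewrite expnS natrM; field.
by apply: lh_midpoint; rewrite //; apply: IHk; lia.
Qed.

Lemma dyadic_approx (a d : R) : 0 <= a <= 1 -> 0 < d ->
  exists k j, (j <= 2 ^ k)%N /\ `|a - j%:R / (2 ^ k)%:R| <= d.
Proof.
move=> /andP[a0 a1] d0; pose k := Num.truncn d^-1.
have kd : d^-1 < (2 ^ k)%:R.
  have /truncn_itv/andP[_ h] : 0 <= d^-1 by rewrite invr_ge0 ltW.
  by apply: (lt_le_trans h); rewrite ler_nat ltn_expl.
have K0 : 0 < (2 ^ k)%:R :> R by rewrite ltr0n expn_gt0.
have /truncn_itv/andP[h1 h2] : 0 <= a * (2 ^ k)%:R by rewrite mulr_ge0 // ltW.
exists k, (Num.truncn (a * (2 ^ k)%:R)); split.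
  rewrite -(ler_nat R) (le_trans h1) // ler_piMl // ltW //.
move: h1 h2; rewrite -ler_pdivrMr // -natr1 => h1 h2.
rewrite ger0_norm ?subr_ge0 //.
have : a < (Num.truncn (a * (2 ^ k)%:R))%:R / (2 ^ k)%:R + (2 ^ k)%:R^-1.
  by rewrite -[X in _ + X]mul1r -mulrDl ltr_pdivlMr.
have : (2 ^ k)%:R^-1 < d by rewrite -[d]invrK ltf_pV2 ?posrE ?invr_gt0.
set x := _ / _; set y := _^-1; lra.
Qed.

(* The exponents for which a power preserves [Q <= P] are closed under
   midpoints, and the powers are continuous in the exponent. *)
Theorem loewner_heinz P Q a : posinv P -> posinv Q -> Q <=o P -> 0 <= a <= 1 ->
  Q `^^ a <=o P `^^ a.
Proof.
move=> pP pQ QP a01; have [m [M [m0 mM sP sQ]]] := posinv_sandwiched2 pP pQ.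
apply: ople_limit => [||e e0]; [exact: opow_sa|exact: opow_sa|].
have e2 : 0 < e / 2 by rewrite divr_gt0.
have [d d0 hd] := @powR_cont_exponent _ m M a _ m0 e2.
have [k [j [jk /hd hx]]] := dyadic_approx a01 d0; set b := j%:R / _ in hx.
have fP c := opowP c pP m0 mM sP; have fQ c := opowP c pQ m0 mM sQ.
have h1 : Q `^^ a <=o Q `^^ b + (e / 2)%:O.
  by apply: (fcal_le sQ (fQ a) (fQ b)) => x /hx; rewrite ler_norml => /andP[]; lra.
have h2 : P `^^ b <=o P `^^ a + (e / 2)%:O.
  by apply: (fcal_le sP (fP b) (fP a)) => x /hx; rewrite ler_norml => /andP[]; lra.
have h3 : Q `^^ b <=o P `^^ b by exact: lh_dyadic.
have ee : e%:O = (e / 2)%:O + (e / 2)%:O :> bop by rewrite scalD -splitr.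
apply: (ople_trans h1); rewrite ee addrA; apply: opleD2r.
exact: ople_trans h3 h2.
Qed.

Lemma fcalZ m M f T S c : sandwiched m M T -> fcal m M f T S ->
  fcal m M (fun x => c * f x) T (c%:C *: S).
Proof.
move=> w fS; have := fcalM w (@fcal_poly _ _ m M T c%:P) fS.
by rewrite peC scalM; apply: fcal_ext => x _; rewrite hornerC.
Qed.

Lemma olog_sa T : posinv T -> sa (olog T).
Proof.
move=> pT; have [m [M [m0 mM w]]] := posinv_sandwiched pT.
exact: fcal_sa w (ofunP approx_pos_ln pT m0 mM w).
Qed.

(* [(x ^ h - 1) / h] tends to [ln x] as [h] tends to 0. *)
Lemma olog_le P Q a : posinv P -> posinv Q -> 0 < a -> Q `^^ a <=o P `^^ a ->
  olog Q <=o olog P.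
Proof.
move=> pP pQ a0 QP; have [m [M [m0 mM sP sQ]]] := posinv_sandwiched2 pP pQ.
apply: ople_limit => [||e e0]; [exact: olog_sa|exact: olog_sa|].
have e2 : 0 < e / 2 by rewrite divr_gt0.
have [d d0 hd] := @ln_limit _ m M _ m0 e2.
(* [h <= a] lets Loewner-Heinz with exponent [h / a] lower the hypothesis to the power [h]. *)
pose h := Num.min a d; have h0 : 0 < h by rewrite lt_min a0.
have hQP : Q `^^ h <=o P `^^ h.
  have -> : h = a * (h / a) by field; rewrite gt_eqF.
  rewrite -(opowM _ _ pP) -(opowM _ _ pQ); apply: loewner_heinz.
  - exact: opow_posinv.
  - exact: opow_posinv.
  - exact: QP.
  apply/andP; split; first by rewrite divr_ge0 // ltW.
  by rewrite ler_pdivrMr // mul1r ge_min lexx.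
have hx x : x \in `[m, M] -> `|h^-1 * (x `^ h - 1) - ln x| <= e / 2.
  by apply: hd; rewrite h0 /= ge_min lexx orbT.
have f1 T : posinv T -> sandwiched m M T ->
    fcal m M (fun x => h^-1 * (x `^ h - 1)) T ((h^-1)%:C *: (T `^^ h - 1)).
  move=> pT w; apply: fcalZ => //.
  have := fcalD (opowP h pT m0 mM w) (@fcal_poly _ _ m M T (-1)%:P).
  have -> : pe (-1)%:P T = -1 by rewrite peC /scal rmorphN scaleNr scale1r.
  apply: fcal_ext => x _.
  by rewrite hornerC.
have f2 T : posinv T -> sandwiched m M T -> fcal m M (@ln R) T (olog T).
  by move=> pT w; exact: ofunP approx_pos_ln pT m0 mM w.
have h1 : olog Q <=o (h^-1)%:C *: (Q `^^ h - 1) + (e / 2)%:O.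
  by apply: (fcal_le sQ (f2 _ pQ sQ) (f1 _ pQ sQ)) => x /hx; rewrite ler_norml => /andP[]; lra.
have h2 : (h^-1)%:C *: (P `^^ h - 1) <=o olog P + (e / 2)%:O.
  by apply: (fcal_le sP (f1 _ pP sP) (f2 _ pP sP)) => x /hx; rewrite ler_norml => /andP[]; lra.
have ee : e%:O = (e / 2)%:O + (e / 2)%:O :> bop by rewrite scalD -splitr.
apply: (ople_trans h1); rewrite ee addrA; apply: opleD2r.
apply: ople_trans h2; apply: opleZ; first by rewrite invr_ge0 ltW.
exact: opleD2r.
Qed.

(* With [Z = Q^(u/2) P^(w/2)] and [Z'] its adjoint, [(Z Z')^l = Z (Z' Z)^(l-1) Z'] and
   [l - 1 <= 0] when [l = (1 + u) / (w + u)]. *)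
Lemma furuta_le1 P Q w u : posinv P -> posinv Q -> Q <=o P -> 1 <= w -> 0 <= u <= 1 ->
  Q `^^ (1 + u) <=o
  (Q `^^ (u / 2) * P `^^ w * Q `^^ (u / 2)) `^^ ((1 + u) / (w + u)).
Proof.
move=> pP pQ QP w1 u01; have /andP[u0 u1] := u01.
have wu : 0 < w + u by lra.
pose Z := Q `^^ (u / 2) * P `^^ (w / 2); pose Z' := P `^^ (w / 2) * Q `^^ (u / 2).
have aZ : adjoint Z' Z by exact: opow_adj.
have iZ : opinv Z by apply: invM; exact: opow_opinv.
have iZ' : opinv Z' by apply: invM; exact: opow_opinv.
have p1 : posinv (1 : bop).
  by apply: (@posinv_ge 1) => //; rewrite /scal scale1r; exact: ople_refl.
pose E := Z * Z'; pose N := Z' * Z; pose l := (1 + u) / (w + u).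
have pE : posinv E by have := posinv_adj aZ iZ' iZ p1; rewrite mulr1.
have pN : posinv N by have := posinv_adj (adjointC aZ) iZ iZ' p1; rewrite mulr1.
have -> : Q `^^ (u / 2) * P `^^ w * Q `^^ (u / 2) = E.
  by rewrite /E /Z /Z' -(opow_half w pP) !mulrA.
have El : E `^^ l = Z * N `^^ (l - 1) * Z'.
  rewrite (@opow_intertwine N E (l - 1) Z pN pE); last by rewrite /N /E mulrA.
  by rewrite -mulrA -[Z * Z']/E -[X in _ = _ * X](opow1 pE) -(opowD _ _ pE) subrK.
have NN : N `^^ (-1) = P `^^ (- (w / 2)) * Q `^^ (- u) * P `^^ (- (w / 2)).
  rewrite -[RHS]mul1r -(opowNl 1 pN) (opow1 pN) -[LHS]mulr1 -mulrA; congr (_ * _).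
  have e : - u = - (u / 2) + - (u / 2) by rewrite -opprD -splitr.
  rewrite e (opowD _ _ pQ) /N /Z /Z' -!mulrA (mulrA (P `^^ (w / 2)) (P `^^ (- (w / 2)))).
  rewrite (opowNr _ pP) mul1r (mulrA (Q `^^ (u / 2)) (Q `^^ (- (u / 2)))) (opowNr _ pQ) mul1r.
  by rewrite (mulrA (Q `^^ (u / 2))) (opowNr _ pQ) mul1r (opowNr _ pP).
(* Here [u <= 1] enters: Loewner-Heinz gives [Q^u <= P^u], so [P^(-u) <= Q^(-u)], and this is
   conjugated by [P^(-w/2)]. *)
have NP : P `^^ (- (w + u)) <=o N `^^ (-1).
  have e : - (w / 2) + - u + - (w / 2) = - (w + u) by field.
  rewrite NN -e (opowD _ _ pP) (opowD _ _ pP).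
  apply: ople_adj; first exact: opow_sa.
  by apply: opow_antitone => //; exact: loewner_heinz.
have NlP : P `^^ (1 - w) <=o N `^^ (l - 1).
  have -> : 1 - w = - (w + u) * (1 - l) by rewrite /l; field; rewrite gt_eqF.
  have -> : l - 1 = -1 * (1 - l) by ring.
  rewrite -(opowM _ _ pP) -(opowM _ _ pN); apply: loewner_heinz => //.
  - exact: opow_posinv.
  - exact: opow_posinv.
  have -> : 1 - l = (w - 1) / (w + u) by rewrite /l; field; rewrite gt_eqF.
  by rewrite ler_pdivlMr // ler_pdivrMr // mul0r mul1r; lra.
rewrite -/l El; have := ople_adj aZ NlP; apply: ople_trans.
(* The powers of [P] add up to 1, which leaves [Q <= P] conjugated by [Q^(u/2)]. *)
have -> : Z * P `^^ (1 - w) * Z' = Q `^^ (u / 2) * P * Q `^^ (u / 2).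
  have e : w / 2 + (1 - w) + w / 2 = 1 by field.
  have mid : P `^^ (w / 2) * P `^^ (1 - w) * P `^^ (w / 2) = P.
    by rewrite (opowDE pP (erefl _)) (opowDE pP e) (opow1 pP).
  by rewrite -[X in _ = _ * X * _]mid /Z /Z' !mulrA.
have -> : Q `^^ (1 + u) = Q `^^ (u / 2) * Q * Q `^^ (u / 2).
  have e : u / 2 + 1 + u / 2 = 1 + u by field.
  by rewrite -[X in _ = _ * X * _](opow1 pQ) (opowDE pQ (erefl _)) (opowDE pQ e).
by apply: ople_adj => //; exact: opow_sa.
Qed.

(* The case [u = 1] applied to [Q^(1 + u)] and the left-hand power in the
   inequality for [u] gives the inequality for [2 u + 1]. *)
Lemma furuta_critical P Q w u : posinv P -> posinv Q -> Q <=o P -> 1 <= w -> 0 <= u ->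
  Q `^^ (1 + u) <=o
  (Q `^^ (u / 2) * P `^^ w * Q `^^ (u / 2)) `^^ ((1 + u) / (w + u)).
Proof.
move=> pP pQ QP w1 u0; have [k uk] : exists k : nat, u <= (2 ^ k)%:R.
  have /truncn_itv/andP[_ h] := u0; exists (Num.truncn u).+1.
  by rewrite (le_trans (ltW h)) // ler_nat ltnW // ltn_expl.
elim: k u u0 uk => [|k IHk] u u0 uk; first by apply: furuta_le1; rewrite // u0.
have [u1|/ltW u1] := leP u 1; first by apply: furuta_le1; rewrite // u0.
(* Solves [u = 2 v + 1]; as [u <= 2^(k+1)], the induction hypothesis covers [v]. *)
pose v := (u - 1) / 2; have v0 : 0 <= v by rewrite divr_ge0 // subr_ge0.
have vk : v <= (2 ^ k)%:R.
  by rewrite ler_pdivrMr //; move: uk; rewrite expnSr natrM; lra.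
have wv : 0 < w + v by lra.
have v1 : 0 < 1 + v by lra.
pose F := Q `^^ (v / 2) * P `^^ w * Q `^^ (v / 2).
have pF : posinv F.
  by apply: posinv_conj; [exact: opow_sa | exact: opow_opinv | exact: opow_posinv].
have IH := IHk v v0 vk; rewrite -/F in IH.
(* This exponent undoes the power [(1 + v) / (w + v)], so [F] itself appears in the middle of the
   new product. *)
have w1' : 1 <= (w + v) / (1 + v) by rewrite ler_pdivlMr // mul1r lerD2r.
have i01 : 0 <= (1 : R) <= 1 by rewrite ler01 lexx.
have := furuta_le1 (opow_posinv ((1 + v) / (w + v)) pF) (opow_posinv (1 + v) pQ) IH w1' i01.
rewrite (opowM _ _ pF) !(opowM _ _ pQ).
have -> : (1 + v) / (w + v) * ((w + v) / (1 + v)) = 1 by field; rewrite !gt_eqF.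
have -> : (1 + v) * (1 + 1) = 1 + u by rewrite /v; field.
have -> : (1 + 1) / ((w + v) / (1 + v) + 1) = (1 + u) / (w + u).
  rewrite /v; field; rewrite !gt_eqF //; lra.
have assoc5 (x y z : bop) : x * (y * z * y) * x = (x * y) * z * (y * x) by rewrite !mulrA.
rewrite (opow1 pF) /F assoc5.
have e : (1 + v) * (1 / 2) + v / 2 = u / 2 by rewrite /v; field.
have e' : v / 2 + (1 + v) * (1 / 2) = u / 2 by rewrite /v; field.
by rewrite (opowDE pQ e) (opowDE pQ e').
Qed.

(** Loewner-Heinz with exponent [th = (w + u) / ((1 + u) q)] applied to the critical case; the side
    condition says [th <= 1]. *)
Theorem furuta P Q w u q : posinv P -> posinv Q -> Q <=o P -> 1 <= w -> 0 <= u ->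
  1 <= q -> w + u <= (1 + u) * q ->
  Q `^^ ((w + u) / q) <=o (Q `^^ (u / 2) * P `^^ w * Q `^^ (u / 2)) `^^ q^-1.
Proof.
move=> pP pQ QP w1 u0 q1 wuq; have wu : 0 < w + u by lra.
have u1 : 0 < 1 + u by lra.
have q0 : 0 < q by lra.
have pF : posinv (Q `^^ (u / 2) * P `^^ w * Q `^^ (u / 2)).
  by apply: posinv_conj; [exact: opow_sa | exact: opow_opinv | exact: opow_posinv].
have := furuta_critical pP pQ QP w1 u0.
pose th := (w + u) / ((1 + u) * q).
move=> /(@loewner_heinz _ _ th (opow_posinv _ pF) (opow_posinv _ pQ)).
have -> : 0 <= th <= 1.
  rewrite /th ler_pdivlMr ?mulr_gt0 // ler_pdivrMr ?mulr_gt0 // mul0r mul1r wuq.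
  by rewrite ltW.
move=> /(_ isT); rewrite (opowM _ _ pF) (opowM _ _ pQ).
have -> : (1 + u) * th = (w + u) / q by rewrite /th; field; rewrite !gt_eqF.
have -> : (1 + u) / (w + u) * th = q^-1 by rewrite /th; field; rewrite !gt_eqF.
by [].
Qed.

End OperatorPowers.

(** * The reduction to the Furuta inequality *)

(** Each [c] is cut into [d * d] and each end [b] into [w] and [d]. It is used with [w = B^(-p)],
    [d = B^(t/n)] and [m = n - 1]. *)
Lemma sandwich_power (A : pzRingType) (a b c d w : A) m :
  w * d = b -> d * w = b -> d * d = c ->
  b * a * (c * a) ^+ m * b = w * (d * a * d) ^+ m.+1 * w.
Proof.
move=> wd dw <-; have -> : (d * a * d) ^+ m.+1 = d * a * (d * d * a) ^+ m * d.
  elim: m => [|m IHm]; first by rewrite expr1 expr0 mulr1.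
  by rewrite exprS IHm exprS !mulrA.
by rewrite -{1}wd -dw !mulrA.
Qed.

Section Conclusion.
Variables (R : realType) (H : hilbertType R).
Local Notation bop := (bop H).
Local Notation "T `^^ a" := (opow T a) (at level 29, left associativity).

Lemma operator_geE (S T : bop) : operator_ge S T <-> T <=o S.
Proof.
have -> : operator_ge S T = positive_operator (S - T : bop).
  by congr positive_operator; apply/funext => x; rewrite bopBE.
exact: posP.
Qed.

Lemma positive_invertibleP (A : H -> H) :
  positive_invertible A -> exists2 P : bop, A = P :> (H -> H) & posinv P.
Proof.
move=> [bA pA [S [bS AS SA]]]; exists (Bop bA) => //; split; first exact/posP.
by exists (Bop bS); split; apply: bopE => x; [exact: SA | exact: AS].
Qed.

Lemma order_of_compression (A B : bop) (n : nat) (s t : R) : posinv A -> posinv B ->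
  (0 < n)%N -> s < t ->
  B `^^ ((s + t) / n%:R) <=o B `^^ (t / n%:R) * A `^^ ((s - t) / n%:R) * B `^^ (t / n%:R) ->
  olog A <=o olog B /\ (n%:R <= t - s -> A <=o B).
Proof.
move=> pA pB n0 st h; have n0' : 0 < n%:R :> R by rewrite ltr0n.
pose p := (t - s) / n%:R; have p0 : 0 < p by rewrite divr_gt0 // subr_gt0.
have pE : (s - t) / n%:R = - p by rewrite /p -mulNr opprB.
have AB : A `^^ p <=o B `^^ p.
  suff : B `^^ (- p) <=o A `^^ (- p).
    by move=> /(opow_antitone pA pB); rewrite opprK.
  have := ople_adj (opow_sa (- (t / n%:R)) pB) h; rewrite !mulrA (opowNl _ pB) mul1r.
  have e : - (t / n%:R) + (s + t) / n%:R + - (t / n%:R) = - p.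
    by rewrite /p; field; rewrite gt_eqF.
  rewrite (opowDE pB (erefl _)) (opowDE pB e) -mulrA (opowNr _ pB) mulr1 pE.
  exact.
split; first exact: olog_le p0 AB.
move=> nts; have p1 : 0 <= p^-1 <= 1.
  rewrite invr_ge0 (ltW p0) invf_le1 // /p ler_pdivlMr // mul1r //.
have := loewner_heinz (opow_posinv p pB) (opow_posinv p pA) AB p1.
by rewrite (opowM _ _ pA) (opowM _ _ pB) divff ?gt_eqF // (opow1 pA) (opow1 pB).
Qed.

Lemma compression_bound (B X : bop) (n : nat) (s t p r : R) : posinv B -> posinv X ->
  (0 < n)%N -> 0 < p -> 0 < r -> r + 2 * p = s + t ->
  B <=o (B `^^ (- p) * X ^+ n * B `^^ (- p)) `^^ r^-1 ->
  (1 < r -> s + t <= (1 + 2 * p) * n%:R) ->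
  B `^^ ((s + t) / n%:R) <=o X.
Proof.
move=> pB pX n0 p0 r0 rp hB hr; have n0' : 0 < n%:R :> R by rewrite ltr0n.
have n1 : 1 <= n%:R :> R by rewrite ler1n.
set Y := _ * _ * _ in hB.
have pXn : posinv (X ^+ n) by rewrite -(opowMn n pX); exact: opow_posinv.
have pY : posinv Y by apply: posinv_conj => //; [exact: opow_sa | exact: opow_opinv].
have YX : B `^^ p * Y * B `^^ p = X ^+ n.
  by rewrite /Y !mulrA (opowNr _ pB) mul1r -mulrA (opowNl _ pB) mulr1.
have XE : (X ^+ n) `^^ n%:R^-1 = X.
  by rewrite -(opowMn n pX) (opowM _ _ pX) divff ?gt_eqF // (opow1 pX).
have [r1|r1] := leP r 1.
- have := loewner_heinz (opow_posinv r^-1 pY) pB hB (_ : 0 <= r <= 1).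
  rewrite (opowM _ _ pY) mulVf ?gt_eqF // (opow1 pY) (ltW r0) r1 => /(_ isT) hY.
  have := ople_adj (opow_sa p pB) hY; rewrite YX.
  have e : p + r + p = s + t by rewrite -rp; ring.
  rewrite (opowDE pB (erefl _)) (opowDE pB e) => hX.
  have n01 : (0 <= (n%:R^-1 : R)) && ((n%:R^-1 : R) <= 1).
    by rewrite invr_ge0 (ltW n0') invf_le1.
  have := loewner_heinz pXn (opow_posinv (s + t) pB) hX n01.
  by rewrite XE (opowM _ _ pB).
(* The larger operator is [Y^(1/r)], whose power [w = r] is [Y]; with [u = 2 p] the product in the
   conclusion is [B^p Y B^p = X^n]. *)
- have := @furuta _ _ _ _ r (2 * p) n%:R (opow_posinv r^-1 pY) pB hB (ltW r1).
  rewrite rp (opowM _ _ pY) mulVf ?gt_eqF // (opow1 pY).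
  have -> : 2 * p / 2 = p by field.
  rewrite YX XE; apply=> //; last exact: hr.
  by rewrite mulr_ge0 // ltW.
Qed.

End Conclusion.

Theorem theorem2p1 (R : realType) (H : hilbertType R) (A B : H -> H)
    (n : nat) (s t : R)
    (A_gt0 : positive_invertible A) (B_gt0 : positive_invertible B)
    (n_ge2 : (2 <= n)%N) (s_gt0 : 0 < s) (lt_st : s < t)
    (hyp : operator_ge
       (operator_pow
          (operator_pow B (s / n%:R)
             \o operator_pow A ((s - t) / n%:R)
             \o iter n.-1 (operator_pow B (2 * t / n%:R)
                             \o operator_pow A ((s - t) / n%:R))
             \o operator_pow B (s / n%:R))
          (n%:R / ((n%:R + 2) * s + (n%:R - 2) * t)))
       B) :
  ((n%:R < (n%:R + 2) * s + (n%:R - 2) * t -> 3 * s - t <= n%:R ->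
      operator_ge (operator_log B) (operator_log A) /\
      (n%:R <= t - s -> operator_ge B A))
   /\
   ((n%:R + 2) * s + (n%:R - 2) * t <= n%:R ->
      operator_ge (operator_log B) (operator_log A) /\
      (n%:R <= t - s -> operator_ge B A))).
Proof.
have [bA eA pA] := positive_invertibleP A_gt0.
have [bB eB pB] := positive_invertibleP B_gt0.
subst A B; move: hyp; rewrite !operator_powE // !operator_logE //.
set a := opow bA _; set b := opow bB _; set c := opow bB _.
set r' := _ + (_ - _) * t.
have n2 : 2 <= n%:R :> R by rewrite ler_nat.
have n0 : 0 < n%:R :> R by lra.
(* [n >= 2] makes the coefficient of [t] nonnegative. *)
have r'0 : 0 < r' by rewrite /r'; nra.
pose p := (t - s) / n%:R; have p0 : 0 < p by rewrite divr_gt0 // subr_gt0.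
pose X : bop H := opow bB (t / n%:R) * a * opow bB (t / n%:R).
have pX : posinv X by apply: posinv_conj; [exact: opow_sa|exact: opow_opinv|exact: opow_posinv].
pose r := r' / n%:R; have r0 : 0 < r by rewrite divr_gt0.
have YE : b \o a \o iter n.-1 (c \o a) \o b =
    (opow bB (- p) * X ^+ n * opow bB (- p) : bop H) :> (H -> H).
  have -> : b \o a \o iter n.-1 (c \o a) \o b =
      (b * a * (c * a) ^+ n.-1 * b : bop H) :> (H -> H).
    by apply/funext => x; rewrite !bopRE bopX_iter.
  congr bop_fun; rewrite -[in RHS](prednK (ltnW n_ge2)); apply: sandwich_power.
  - by apply: opowDE => //; rewrite /p; field; rewrite gt_eqF.
  - by apply: opowDE => //; rewrite /p; field; rewrite gt_eqF.
  - by apply: opowDE => //; field; rewrite gt_eqF.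
have pY : posinv (opow bB (- p) * X ^+ n * opow bB (- p)).
  apply: posinv_conj; [exact: opow_sa|exact: opow_opinv|].
  by rewrite -(opowMn n pX); exact: opow_posinv.
rewrite YE operator_powE // => /operator_geE; rewrite -[_ / r']invf_div -/r => hB.
have fin : (1 < r -> 3 * s - t <= n%:R) ->
    olog bA <=o olog bB /\ (n%:R <= t - s -> bA <=o bB).
  move=> hr; apply: (@order_of_compression _ _ bA bB n s t) => //; first exact: ltnW.
  apply: (@compression_bound _ _ bB X n s t p r) => //; first exact: ltnW.
    by rewrite /r /r' /p; field; rewrite gt_eqF.
  move=> /hr h; have -> : (1 + 2 * p) * n%:R = n%:R + 2 * (t - s).
    by rewrite /p; field; rewrite gt_eqF.
  lra.
have fin' : (1 < r -> 3 * s - t <= n%:R) ->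
    operator_ge (olog bB) (olog bA) /\ (n%:R <= t - s -> operator_ge bB bA).
  by move=> /fin[h1 h2]; split; [exact/operator_geE | move=> /h2/operator_geE].
(* In (I) the side condition is the hypothesis [3 s - t <= n]; in (II) it is vacuous, since
   [r <= 1]. *)
split=> [_ h|h]; apply: fin' => // r1.
by move: r1; rewrite /r ltr_pdivlMr // mul1r ltNge h.
Qed.
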